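(* Let $G$ be a group, $X,Z$ compact Hausdorff spaces, $\psi: G \curvearrowright X$ and $\varphi: G \curvearrowright Z$ actions by homeomorphisms, $P$ the set of bounded parabolic points of $Z$, and $\alpha: X \rightarrow Z$ a continuous surjective equivariant map such that $\#\alpha^{-1}(x) = 1$ for all $x \in Z\setminus P$. If for every $p \in P$ the restricted action $\psi|_{Stab_{\varphi}p\times X}$ has the convergence property, then there exist a parabolic blowup $Z\ltimes \mathcal{C}$ of $Z$, with projection map $\pi':Z\ltimes\mathcal C\to Z$, and a $G$-equivariant homeomorphism $T:X\to Z\ltimes\mathcal C$ such that $\pi'\circ T=\alpha$.
   Context: Groups are discrete. An action of a group $H$ on a locally compact Hausdorff space $V$ is properly discontinuous if for every compact $K\subseteq V$ the set $\{h\in H: hK\cap K\neq\emptyset\}$ is finite, and cocompact if $HK=V$ for some compact $K\subseteq V$. A point $p\in Z$ is bounded parabolic for $\varphi:G\curvearrowright Z$ if $Stab_\varphi p$ acts properly discontinuously and cocompactly on $Z\setminus\{p\}$. An action by homeomorphisms of a group on a compact Hausdorff space $X$ has the convergence property if every wandering net (net of pairwise distinct group elements) has a subnet $\Phi'$ for which there are $a,b\in X$ such that $\Phi'|_{X\setminus\{b\}}$ converges to $a$ uniformly on compact subsets of $X\setminus\{b\}$. A compact Hausdorff space has a unique compatible uniform structure; for an entourage $u$, a subset $A$ is $u$-small if $A\times A\subseteq u$. Gluing notation: $V+_fC$ denotes a topological space with underlying set $V\sqcup C$ in which $V$ is open and $V$, $C$ carry their given topologies; $f$ records the topology via $f(A)=\overline{A}\cap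 C$ for $A$ closed in $V$ (so $B$ is closed iff $B\cap V$, $B\cap C$ are closed in $V$, $C$ and $f(B\cap V)\subseteq B$). $EPers(H)$, for a discrete group $H$: compact Hausdorff spaces $H+_\partial C$ with an action $L+\eta$ of $H$ by homeomorphisms ($L$ left multiplication on $H$, $\eta$ an action on $C$) such that for every entourage $u$ and every finite $F\subseteq H$, $hF$ is $u$-small for all but finitely many $h\in H$. Given $H+_\partial C\in EPers(H)$ and a properly discontinuous cocompact action of $H$ on a locally compact Hausdorff $V$ with compact $K\subseteq V$ such that $HK=V$, let $V+_{\partial_\Pi}C$ be the gluing given by $\partial_\Pi(S)=\partial(\{h\in H: hK\cap S\neq\emptyset\})$ for $S$ closed in $V$; it is compact Hausdorff and independent of $K$. Parabolic blowup: let $P'\subseteq P$ be a set of representatives of the $G$-orbits in $P$, and for each $p\in P'$ let $Stab_\varphi p+_{\partial_p}C_p\in EPers(Stab_\varphi p)$ with action $L_p+\eta_p$; $\mathcal C=\{C_p\}_{p\in P'}$. For $p\in P'$ and $q$ in its orbit choose $h_{p,q}\in G$ with $\varphi(h_{p,q},p)=q$, $h_{p,p}=1$; put $C_q=C_p$ and let $Stab_\varphi q+_{\partial_q}C_q$ have the topology making the map $x\mapsto h_{p,q}^{-1}xh_{p,q}$ on $Stab_\varphi q$ together with $\mathrm{id}$ on $C_q=C_p$ a homeomorphism onto $Stab_\varphi p+_{\partial_p}C_p$. Let $X_q=(Z\setminus\{q\})+_{(\partial_q)_\Pi}C_q$ and let $\pi_q:X_q\to Z$ be the identity on $Z\setminus\{q\}$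 and send $C_q$ to $q$. Then $Z\ltimes\mathcal C=\{(z,(x_q)_{q\in P}): \pi_q(x_q)=z\ \forall q\}\subseteq Z\times\prod_{q\in P} X_q$, with projection $(z,(x_q))\mapsto z$. $G$ acts on it by the action induced by $\varphi$ and the maps $X_q\to X_{\varphi(g,q)}$ equal to $\varphi(g,\cdot)$ on $Z\setminus\{q\}$ and to $\eta_p(h_{p,\varphi(g,q)}^{-1}gh_{p,q},\cdot)$ on $C_q$. ''A parabolic blowup of $Z$'' means such a space with this action, for some choice of the family.
   Formalization: The case where Z is a single point and X has exactly two points is excluded; there the claim can fail, e.g. for G the integers with the generator swapping the two points of X. *)

(* Defs.v *)
From HB Require Import structures.
From mathcomp Require Import all_boot all_order all_algebra.
From mathcomp Require Import all_classical all_reals all_analysis.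

Set Implicit Arguments.
Unset Strict Implicit.
Unset Printing Implicit Defensive.

Local Open Scope classical_set_scope.
Local Open Scope group_scope.

Definition homeomorphism (X Y : topologicalType) (f : X -> Y) : Prop :=
  continuous f /\
  exists g : Y -> X, [/\ continuous g, cancel f g & cancel g f].

(* Actions by homeomorphisms of a discrete group; [act g^-1] is a continuous
   inverse of [act g]. *)
Record action (G : groupType) (X : topologicalType) := Action {
  act :> G -> X -> X;
  act1 : forall x, act 1 x = x;
  actM : forall g h x, act (g * h) x = act g (act h x);
  act_continuous : forall g, continuous (act g)
}.

Section ActionTheory.
Variables (G : groupType) (X : topologicalType) (f : action G X).

Lemma actK g : cancel (f g) (f g^-1).
Proof. by move=> x; rewrite -actM mulVg act1. Qed.

Lemma actVK g : cancel (f g^-1) (f g).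
Proof. by move=> x; rewrite -actM mulgV act1. Qed.

Lemma act_inj g : injective (f g).
Proof. exact: can_inj (actK g). Qed.

Definition properly_discontinuous : Prop :=
  forall K : set X, compact K ->
    finite_set [set g | (f g @` K) `&` K !=set0].

Definition cocompact_by (K : set X) : Prop :=
  compact K /\ \bigcup_g (f g @` K) = [set: X].

Definition cocompact : Prop := exists K, cocompact_by K.

End ActionTheory.

Section Stabilizer.
Variables (G : groupType) (Z : topologicalType) (phi : action G Z) (p : Z).

Definition stab_set : set G := [set g | phi g p = p].

Definition stab : Type := set_type stab_set.

HB.instance Definition _ := SubChoice.on stab.

Lemma stab_group_closed : group_closed [in stab_set].
Proof.
split=> [|g h]; rewrite !inE /stab_set /=; first exact: act1.
by move=> gp hp; rewrite actM -{1}hp actK.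
Qed.

HB.instance Definition _ :=
  SubChoice_isSubGroup.Build G [in stab_set] stab stab_group_closed.

Lemma stabP (g : stab) : phi (val g) p = p.
Proof. exact: (set_mem (valP g)). Qed.

Definition mk_stab g (gp : phi g p = p) : stab := SigSub (mem_set gp).

Lemma stab_val1 : \val (1 : stab) = 1 :> G.
Proof. exact: val1. Qed.

Lemma stab_valM (g h : stab) : \val (g * h) = \val g * \val h :> G.
Proof. exact: valM. Qed.

Section Restrict.
Variables (X : topologicalType) (psi : action G X).

Let restr (g : stab) (x : X) : X := psi (\val g) x.

Let restr1 x : restr 1 x = x.
Proof. by rewrite /restr stab_val1 act1. Qed.

Let restrM g h x : restr (g * h) x = restr g (restr h x).
Proof. by rewrite /restr stab_valM actM. Qed.

Definition stab_restrict : action stab X :=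
  @Action stab X restr restr1 restrM
    (fun g => @act_continuous _ _ psi (\val g)).

End Restrict.

Definition puncture : topologicalType := set_type [set~ p].

Definition mk_puncture z (zp : z <> p) : puncture :=
  SigSub (mem_set (zp : [set~ p] z)).

Lemma punctureP (z : puncture) : val z <> p.
Proof. exact: (set_mem (valP z)). Qed.

Section PunctureAction.

Lemma puncture_act_subproof (g : stab) (z : puncture) :
  phi (\val g) (\val z) <> p.
Proof. by rewrite -[in RHS](stabP g) => /act_inj; exact: punctureP. Qed.

Let pact (g : stab) (z : puncture) : puncture :=
  mk_puncture (@puncture_act_subproof g z).

Let pact1 z : pact 1 z = z.
Proof.
apply: val_inj.
exact: (etrans (congr1 (fun g => phi g (\val z)) stab_val1) (act1 _ _)).
Qed.

Let pactM g h z : pact (g * h) z = pact g (pact h z).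
Proof.
apply: val_inj.
exact: (etrans (congr1 (phi^~ (\val z)) (stab_valM g h)) (actM _ _ _ _)).
Qed.

Let pact_continuous g : continuous (pact g).
Proof.
apply: continuous_comp_initial => z.
have vc : continuous (set_val : puncture -> Z) by exact: initial_continuous.
exact: (continuous_comp (vc z) (@act_continuous _ _ phi (\val g) _)).
Qed.

Definition puncture_action : action stab puncture :=
  @Action stab puncture pact pact1 pactM pact_continuous.

End PunctureAction.

Definition bounded_parabolic : Prop :=
  properly_discontinuous puncture_action /\ cocompact puncture_action.

End Stabilizer.

Definition parabolic_points (G : groupType) (Z : topologicalType)
  (phi : action G Z) : set Z := [set p | bounded_parabolic phi p].

(* The relation u is an entourage of a uniform structure inducing the topology
   of X.  When X is compact Hausdorff there is exactly one such structure. *)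
Definition compatible_uniformity (X : topologicalType)
  (ent : set_system (X * X)) : Prop :=
  [/\ Filter ent,
      (forall u, ent u -> diagonal `<=` u),
      (forall u, ent u -> ent (u^-1)%relation),
      (forall u, ent u -> exists2 v, ent v & (v \; v `<=` u)%relation) &
      @nbhs X X = nbhs_ ent].

Definition is_entourage (X : topologicalType) (u : set (X * X)) : Prop :=
  exists2 ent, compatible_uniformity ent & ent u.

Definition small (X : Type) (u : set (X * X)) (A : set X) : Prop :=
  A `*` A `<=` u.

Record directed := Directed {
  dir_sort :> Type;
  dir_le : dir_sort -> dir_sort -> Prop;
  dir_inhabited : inhabited dir_sort;
  dir_refl : forall d, dir_le d d;
  dir_trans : forall d e f, dir_le d e -> dir_le e f -> dir_le d f;
  dir_upper : forall d e, exists2 f, dir_le d f & dir_le e f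
}.

(* Without the second clause a one-term net would be wandering, and only spaces
   with at most two points could have the convergence property. *)
Definition wandering (G : Type) (D : directed) (Phi : D -> G) : Prop :=
  injective Phi /\ ~ (exists d : D, forall e : D, dir_le e d).

Definition cofinal_map (D E : directed) (j : E -> D) : Prop :=
  forall d : D, exists e0 : E, forall e : E, dir_le e0 e -> dir_le d (j e).

Definition net_cvg_uniformly_to (X : topologicalType) (D : directed)
  (F : D -> X -> X) (K : set X) (a : X) : Prop :=
  forall u : set (X * X), is_entourage u ->
    exists d0 : D, forall d : D, dir_le d0 d -> forall x, K x -> u (a, F d x).

Definition convergence_property (G : groupType) (X : topologicalType)
  (psi : action G X) : Prop :=
  forall (D : directed) (Phi : D -> G), wandering Phi ->
  exists (E : directed) (j : E -> D), cofinal_map j /\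
  exists a b : X, forall K : set X, compact K -> K `<=` [set~ b] ->
    net_cvg_uniformly_to (fun e => psi (Phi (j e))) K a.

(* The maps A |-> closure A `&` C, for A closed in V, coming from the topologies
   on the disjoint union of V and C that induce the given topologies on V and C
   and in which V is open. *)
Record gluing_map (V C : topologicalType) := GluingMap {
  gmap :> set V -> set C;
  gmap0 : gmap set0 = set0;
  gmapU : forall A B, closed A -> closed B -> gmap (A `|` B) = gmap A `|` gmap B;
  gmap_closed : forall A, closed A -> closed (gmap A)
}.

Definition glue (V C : topologicalType) (f : gluing_map V C) : Type :=
  (V + C)%type.

Section Gluing.
Variables (V C : topologicalType) (f : gluing_map V C).
Local Notation glue := (glue f).

Definition glue_closed (B : set glue) : Prop :=
  [/\ closed (inl @^-1` B : set V), closed (inr @^-1` B : set C) &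
      f (inl @^-1` B) `<=` inr @^-1` B].

Definition glue_open (B : set glue) : Prop := glue_closed (~` B).

Lemma gmapS A B : closed A -> closed B -> A `<=` B -> f A `<=` f B.
Proof. by move=> cA cB /setUidPr <-; rewrite gmapU //; exact: subsetUl. Qed.

Lemma glue_openT : glue_open setT.
Proof.
rewrite /glue_open setCT; split; rewrite ?preimage_set0; try exact: closed0.
by rewrite gmap0.
Qed.

Lemma glue_openI : setI_closed glue_open.
Proof.
move=> A B [A1 A2 A3] [B1 B2 B3]; rewrite /glue_open setCI.
split; rewrite ?preimage_setU; try exact: closedU.
by rewrite gmapU //; exact: setUSS.
Qed.

Lemma glue_open_bigcup (I : Type) (F : I -> set glue) :
  (forall i, glue_open (F i)) -> glue_open (\bigcup_i F i).
Proof.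
move=> oF; rewrite /glue_open setC_bigcup.
have cl : closed (inl @^-1` (\bigcap_i ~` F i) : set V).
  rewrite preimage_bigcap; apply: closed_bigI => i _.
  by case: (oF i).
split=> //; first by rewrite preimage_bigcap; apply: closed_bigI => i _; case: (oF i).
move=> c fc i _; case: (oF i) => c1 _; apply.
by apply: gmapS fc => // v; apply.
Qed.

HB.instance Definition _ := Choice.copy glue (V + C)%type.
HB.instance Definition _ :=
  isOpenTopological.Build glue glue_openT glue_openI glue_open_bigcup.

Lemma closed_glueE (B : set glue) : closed B = glue_closed B.
Proof. by rewrite -openC -[in RHS](setCK B). Qed.

End Gluing.

Section EPers.
Variable H : groupType.

(* The action L + eta, with L the left multiplication. *)
Definition glue_act (C : topologicalType)
  (bd : gluing_map (discrete_topology H) C) (eta : action H C) (h : H)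
  (x : glue bd) : glue bd :=
  match x with
  | inl k => inl (h * k)
  | inr c => inr (eta h c)
  end.

Record EPers := {
  ep_space : topologicalType;
  ep_bd : gluing_map (discrete_topology H) ep_space;
  ep_act : action H ep_space;
  ep_compact : compact [set: glue ep_bd];
  ep_hausdorff : hausdorff_space (glue ep_bd);
  ep_act_continuous : forall h,
    continuous (glue_act ep_act h : glue ep_bd -> glue ep_bd);
  ep_perspective : forall u : set (glue ep_bd * glue ep_bd), is_entourage u ->
    forall F : set H, finite_set F ->
      finite_set [set h | ~ small u (inl @` [set h * k | k in F])]
}.

End EPers.

(* The gluing map written with a subscript Pi. *)
Section GluingPi.
Variables (H : groupType) (V C : topologicalType) (rho : action H V).
Variables (K : set V) (bd : gluing_map (discrete_topology H) C).

Definition hits (S : set V) : set (discrete_topology H) :=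
  [set h | (rho h @` K) `&` S !=set0].

Let pi_map (S : set V) : set C := bd (hits S).

Let pi_map0 : pi_map set0 = set0.
Proof.
rewrite /pi_map (_ : hits set0 = set0) ?gmap0 //.
by apply/seteqP; split=> // h [v []].
Qed.

Let pi_mapU A B : closed A -> closed B ->
  pi_map (A `|` B) = pi_map A `|` pi_map B.
Proof.
move=> _ _; rewrite /pi_map -gmapU; try exact: discrete_closed.
congr (bd _); apply/seteqP; split=> h /=.
  by case=> v [Kv [Av|Bv]]; [left|right]; exists v.
by case=> -[v [Kv Sv]]; exists v; split=> //; [left|right].
Qed.

Let pi_map_closed A : closed A -> closed (pi_map A).
Proof. by move=> _; apply: gmap_closed; exact: discrete_closed. Qed.

Definition gluing_pi : gluing_map V C := GluingMap pi_map0 pi_mapU pi_map_closed.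

End GluingPi.

(* For bijective c, the map A |-> bd (c A) is the one for which c + id is a
   homeomorphism. *)
Section GluingTransport.
Variables (H K : groupType) (C : topologicalType) (c : H -> K).
Variable bd : gluing_map (discrete_topology K) C.

Let tr_map (A : set (discrete_topology H)) : set C := bd (c @` A).

Let tr_map0 : tr_map set0 = set0.
Proof. by rewrite /tr_map image_set0 gmap0. Qed.

Let tr_mapU A B : closed A -> closed B -> tr_map (A `|` B) = tr_map A `|` tr_map B.
Proof.
move=> _ _; rewrite /tr_map image_setU gmapU //; exact: discrete_closed.
Qed.

Let tr_map_closed A : closed A -> closed (tr_map A).
Proof. by move=> _; apply: gmap_closed; exact: discrete_closed. Qed.

Definition gluing_transport : gluing_map (discrete_topology H) C :=
  GluingMap tr_map0 tr_mapU tr_map_closed.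

Lemma gluing_transport_homeo : bijective c ->
  homeomorphism (fun x : glue gluing_transport =>
    match x with inl h => inl (c h) | inr y => inr y end : glue bd).
Proof.
move=> [d cK dK]; set f := (X in homeomorphism X).
have closedP (S T : topologicalType) (g : S -> T) :
    (forall B, closed B -> closed (g @^-1` B)) -> continuous g.
  move=> h; apply/continuousP => A oA; rewrite -[_ @^-1` _]setCK openC.
  by rewrite preimage_setC; apply: h; rewrite closedC.
split; last exists (fun x : glue bd =>
    match x with inl k => inl (d k) | inr y => inr y end); last split.
- apply: closedP => B; rewrite !closed_glueE => -[B1 B2 B3].
  split=> //; first exact: discrete_closed.
  apply: (subset_trans _ B3); apply: (@gmapS _ _ bd).
  + exact: discrete_closed.
  + exact: discrete_closed.
  + by move=> _ [h Bh <-].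
- apply: closedP => B; rewrite !closed_glueE => -[B1 B2 B3].
  split=> //; first exact: discrete_closed.
  apply: (subset_trans _ B3); apply: (@gmapS _ _ bd).
  + exact: discrete_closed.
  + exact: discrete_closed.
  + by move=> k Bk; exists (d k); rewrite ?dK.
- by case=> //= h; rewrite cK.
- by case=> //= k; rewrite dK.
Qed.

End GluingTransport.

Section Translate.
Variables (G : groupType) (Z : topologicalType) (phi : action G Z).
Variables (g : G) (p q : Z) (e : phi g p = q).

Lemma conj_stab_subproof (x : stab phi q) : phi (\val x ^ g) p = p.
Proof. by rewrite conjgE !actM e stabP -e actK. Qed.

Definition conj_stab (x : stab phi q) : stab phi p :=
  mk_stab (@conj_stab_subproof x).

Lemma puncture_shift_subproof (z : puncture p) : phi g (\val z) <> q.
Proof. by rewrite -e => /act_inj; exact: punctureP. Qed.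

Definition puncture_shift (z : puncture p) : puncture q :=
  mk_puncture (@puncture_shift_subproof z).

Lemma puncture_shift_continuous : continuous puncture_shift.
Proof.
apply: continuous_comp_initial => z.
have vc : continuous (set_val : puncture p -> Z) by exact: initial_continuous.
exact: (continuous_comp (vc z) (@act_continuous _ _ phi g _)).
Qed.

Lemma conj_stab_bij : bijective conj_stab.
Proof.
have eV (k : stab phi p) : phi (\val k ^ g^-1) q = q.
  by rewrite conjgE invgK !actM -e actK stabP.
exists (fun k => mk_stab (eV k)) => k; apply: val_inj.
  exact: (conjgK g (\val k)).
exact: (conjgKV g (\val k)).
Qed.

End Translate.

Lemma bounded_parabolic_act (G : groupType) (Z : topologicalType)
  (phi : action G Z) (g : G) (p : Z) :
  bounded_parabolic phi p -> bounded_parabolic phi (phi g p).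
Proof.
have e : phi g p = phi g p by [].
have eV : phi g^-1 (phi g p) = p by rewrite actK.
pose s := puncture_shift e; pose t := puncture_shift eV.
have sK : cancel s t by move=> z; apply: val_inj; exact: (actK phi g (\val z)).
have tK : cancel t s by move=> z; apply: val_inj; exact: (actVK phi g (\val z)).
have cs : continuous s by exact: puncture_shift_continuous.
have ct : continuous t by exact: puncture_shift_continuous.
have [c cK dK] := conj_stab_bij e.
have tE h z : t (puncture_action phi _ h z)
    = puncture_action phi p (conj_stab e h) (t z).
  apply: val_inj; change (phi g^-1 (phi (\val h) (\val z))
    = phi (\val h ^ g) (phi g^-1 (\val z))).
  by rewrite conjgE -!actM !mulgA mulgK.
move=> [pd [K [cK' KT]]]; split.
  move=> L cL.
  have ctL : compact (t @` L).
    by apply: continuous_compact => //; apply: continuous_subspaceT.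
  have fin := pd _ ctL.
  apply: sub_finite_set (finite_image c fin) => h [z [[y Ly <-] Lhy]].
  exists (conj_stab e h) => //; exists (t (puncture_action phi _ h y)).
  by split; [exists (t y); [exists y|rewrite tE]|exists (puncture_action phi _ h y)].
exists (s @` K); split.
  by apply: continuous_compact => //; apply: continuous_subspaceT.
apply/seteqP; split=> // z _.
have : [set: puncture p] (t z) by [].
rewrite -KT => -[k _ [y Ky kyE]].
exists (c k) => //; exists (s y); first by exists y.
by apply: (can_inj tK); rewrite tE dK sK.
Qed.

(* The choices entering a parabolic blowup.  [bf_reps] is the set of orbit
   representatives, [bf_rep q] the representative of the orbit of q, and [bf_h q]
   the element sending [bf_rep q] to q.  The compact sets [bf_K q] are only
   auxiliary: they do not change the topology of the blowup. *)
Record blowup_family (G : groupType) (Z : topologicalType) (phi : action G Z) := {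
  bf_reps : set Z;
  bf_reps_parabolic : bf_reps `<=` parabolic_points phi;
  bf_rep : parabolic_points phi -> bf_reps;
  bf_h : parabolic_points phi -> G;
  bf_hE : forall q, phi (bf_h q) (\val (bf_rep q)) = \val q;
  bf_reps_uniq : forall (p p' : bf_reps) (g : G),
    phi g (\val p) = \val p' -> p = p';
  bf_h1 : forall q, \val (bf_rep q) = \val q -> bf_h q = 1;
  bf_eper : forall p : bf_reps, EPers (stab phi (\val p));
  bf_K : forall q : parabolic_points phi, set (puncture (\val q));
  bf_KP : forall q, cocompact_by (puncture_action phi (\val q)) (@bf_K q)
}.

Arguments bf_K {G Z phi} b q _.

Section Blowup.
Variables (G : groupType) (Z : topologicalType) (phi : action G Z).
Variable D : blowup_family phi.

Local Notation P := (parabolic_points phi).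

Definition fiber (q : P) : topologicalType := ep_space (bf_eper (bf_rep D q)).

Definition fiber_bd (q : P) :
    gluing_map (discrete_topology (stab phi (\val q))) (fiber q) :=
  gluing_transport (conj_stab (bf_hE D q)) (ep_bd (bf_eper (bf_rep D q))).

Definition piece (q : P) : topologicalType :=
  glue (gluing_pi (puncture_action phi (\val q)) (bf_K D q) (fiber_bd q)).

Definition piece_proj (q : P) (x : piece q) : Z :=
  match x with
  | inl z => \val z
  | inr _ => \val q
  end.

Definition blowup_set : set (Z * prod_topology piece) :=
  [set zx | forall q, piece_proj (zx.2 q) = zx.1].

Definition blowup : topologicalType := set_type blowup_set.

Definition blowup_proj (x : blowup) : Z := (\val x).1.

Section Move.
Variables (g : G) (q q' : P) (e : phi g (\val q) = \val q').

Lemma move_rep : bf_rep D q = bf_rep D q'.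
Proof.
apply: (bf_reps_uniq (g := (bf_h D q')^-1 * g * bf_h D q)).
by rewrite !actM bf_hE e -(bf_hE D q') actK.
Qed.

Lemma move_stab_subproof :
  phi ((bf_h D q')^-1 * g * bf_h D q) (\val (bf_rep D q)) = \val (bf_rep D q).
Proof. by rewrite !actM bf_hE e -(bf_hE D q') actK move_rep. Qed.

(* The points q and q' have the same representative, so that their fibers are
   the same space, up to the cast. *)
Definition fiber_move (c : fiber q) : fiber q' :=
  eq_rect (bf_rep D q) (fun p => ep_space (bf_eper p))
    (ep_act (bf_eper (bf_rep D q)) (mk_stab move_stab_subproof) c)
    (bf_rep D q') move_rep.

Definition piece_move (x : piece q) : piece q' :=
  match x with
  | inl z => inl (puncture_shift e z)
  | inr c => inr (fiber_move c)
  end.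

Lemma piece_moveE x : piece_proj (piece_move x) = phi g (piece_proj x).
Proof. by case: x => [z|c] //=; rewrite e. Qed.

End Move.

Definition act_point (g : G) (q : P) : P :=
  SigSub (mem_set (bounded_parabolic_act g (set_mem (valP q)))).

Lemma act_pointVK (g : G) (q : P) : phi g (\val (act_point g^-1 q)) = \val q.
Proof. exact: (actVK phi g (\val q)). Qed.

Lemma blowup_act_subproof (g : G) (x : blowup) :
  blowup_set (phi g (\val x).1,
    fun q => piece_move (act_pointVK g q) ((\val x).2 (act_point g^-1 q))).
Proof. by move=> q; rewrite /= piece_moveE (set_mem (valP x)). Qed.

(* The q-th coordinate of g x is the image of the (g^-1 q)-th coordinate of x. *)
Definition blowup_act (g : G) (x : blowup) : blowup :=
  SigSub (mem_set (@blowup_act_subproof g x)).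

Lemma ep_act_cast (p p' : bf_reps D) (E : p = p') (k : stab phi (\val p))
    (k' : stab phi (\val p')) (c : ep_space (bf_eper p)) :
  \val k = \val k' ->
  ep_act (bf_eper p') k'
    (eq_rect p (fun p => ep_space (bf_eper p)) c p' E) =
  eq_rect p (fun p => ep_space (bf_eper p)) (ep_act (bf_eper p) k c) p' E.
Proof. by case: p' / E k' => k' /= /val_inj ->. Qed.

Lemma piece_move_comp (g h : G) (q q' q'' : P) (e : phi h (\val q) = \val q')
    (e' : phi g (\val q') = \val q'')
    (e'' : phi (g * h) (\val q) = \val q'') (x : piece q) :
  piece_move e' (piece_move e x) = piece_move e'' x.
Proof.
case: x => [z|c] /=.
  by congr inl; apply: val_inj; exact/esym/(actM phi g h (\val z)).
congr inr; rewrite /fiber_move.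
have kP : phi ((bf_h D q'')^-1 * g * bf_h D q') (\val (bf_rep D q))
    = \val (bf_rep D q).
  by rewrite (move_rep e); exact: move_stab_subproof.
rewrite (@ep_act_cast _ _ _ (mk_stab kP)) // -actM.
have -> : mk_stab kP * mk_stab (move_stab_subproof e)
    = mk_stab (move_stab_subproof e'').
  apply: val_inj; rewrite stab_valM.
  change ((bf_h D q'')^-1 * g * bf_h D q' * ((bf_h D q')^-1 * h * bf_h D q)
    = (bf_h D q'')^-1 * (g * h) * bf_h D q).
  by rewrite !mulgA mulgK.
rewrite rew_compose.
by rewrite (Prop_irrelevance (eq_trans _ _) (move_rep e'')).
Qed.

Lemma piece_move1 (q : P) (e : phi 1 (\val q) = \val q) (x : piece q) :
  piece_move e x = x.
Proof.
case: x => [z|c] /=.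
  by congr inl; apply: val_inj; exact: (act1 phi (\val z)).
congr inr; rewrite /fiber_move.
have -> : mk_stab (move_stab_subproof e) = 1.
  apply: val_inj; rewrite stab_val1.
  change ((bf_h D q)^-1 * 1 * bf_h D q = 1).
  by rewrite mulg1 mulVg.
by rewrite act1 (Prop_irrelevance (move_rep e) erefl).
Qed.

Lemma piece_move_eq (x : prod_topology piece) (g : G) (q q1 q2 : P)
    (e1 : phi g (\val q1) = \val q) (e2 : phi g (\val q2) = \val q) :
  piece_move e1 (x q1) = piece_move e2 (x q2).
Proof.
have E : q1 = q2 by apply: val_inj; apply: (@act_inj _ _ phi g); rewrite e1 e2.
by case: q2 / E e2 => e2; rewrite (Prop_irrelevance e1 e2).
Qed.

Lemma blowup_act1 x : blowup_act 1 x = x.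
Proof.
apply: val_inj; case: x => -[z x] xP /=; congr (_, _); first exact: act1.
apply: functional_extensionality_dep => q.
have e : phi 1 (\val q) = \val q by exact: act1.
by rewrite (piece_move_eq x _ e) piece_move1.
Qed.

Lemma blowup_actM g h x : blowup_act (g * h) x = blowup_act g (blowup_act h x).
Proof.
apply: val_inj; case: x => -[z x] xP /=; congr (_, _); first exact: actM.
apply: functional_extensionality_dep => q.
set q1 := act_point g^-1 q; set q2 := act_point h^-1 q1.
have e : phi (g * h) (\val q2) = \val q by rewrite actM !act_pointVK.
by rewrite (piece_move_eq x _ e) (piece_move_comp _ _ e).
Qed.

End Blowup.

(* Main.v *)
Require Import Defs.
From HB Require Import structures.
From mathcomp Require Import all_boot all_order all_algebra.
From mathcomp Require Import all_classical all_reals all_analysis.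

(* Fix a parabolic point p, with stabilizer H and fiber C = alpha^-1(p).  If
   some x0 lies outside C, then limit points of the orbits of x0 define a
   topology on the disjoint union of H and C: a point c of C is in the closure
   of A when infinitely many h in A bring h x0 close to c.  If Z = {p}, so that
   C = X, one uses instead three distinct points of X, at least two of which must
   come close to c; this works because a collapsing sequence moves all points but
   one to the same limit (and a one-point X is trivial).  The common properties
   of these notions of nearness (record nearness) produce an element of EPers(H).

   The main estimate (finite_straddle) says that, for L compact outside C and
   disjoint closed E, E', only finitely many h L meet both E and E'.  It implies
   that the map from X to (Z - {p}) + C given by alpha outside C and by the
   identity on C is continuous and closed.  These maps, one for each parabolic
   point, are the coordinates of a continuous bijection of X onto the blowup;
   closedness makes the blowup Hausdorff, and X is compact. *)

Set Implicit Arguments.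
Unset Strict Implicit.
Unset Printing Implicit Defensive.

Local Open Scope classical_set_scope.
Local Open Scope card_scope.

(** * Topological preliminaries *)

Lemma continuous_closed_preimage (S T : topologicalType) (f : S -> T) :
  (forall B, closed B -> closed (f @^-1` B)) -> continuous f.
Proof.
move=> h; apply/continuousP => A oA; rewrite -[_ @^-1` _]setCK openC.
by rewrite preimage_setC; apply: h; rewrite closedC.
Qed.

Lemma closed_preimage_continuous (S T : topologicalType) (f : S -> T) B :
  continuous f -> closed B -> closed (f @^-1` B).
Proof. by move=> fc cB; apply: preimage_closed => // x _; exact: fc. Qed.

Section CompactSpace.
Variable X : topologicalType.
Hypotheses (cptX : compact [set: X]) (hsdfX : hausdorff_space X).

Lemma closed_nbhs_in (x : X) (U : set X) : nbhs x U ->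
  exists E, [/\ closed E, nbhs x E & E `<=` U].
Proof.
move=> xU; have [] := @compact_regular X x [set: X] hsdfX cptX filterT U xU.
move=> V xV VU; exists (closure V); split => //; first exact: closed_closure.
by apply: filterS xV; exact: subset_closure.
Qed.

Lemma closed_nbhs_sep (x y : X) : x <> y ->
  exists E E', [/\ closed E, closed E', nbhs x E, nbhs y E' & E `&` E' = set0].
Proof.
move=> xy; have : open (~` [set y]).
  by rewrite openC; apply: accessible_closed_set1; exact: hausdorff_accessible.
move=> oy; have /closed_nbhs_in[E [cE xE Ey]] : nbhs x (~` [set y]).
  by apply: open_nbhs_nbhs.
have /closed_nbhs_in[E' [cE' yE' E'E]] : nbhs y (~` E).
  by apply: open_nbhs_nbhs; split; [rewrite openC|move/Ey => /=].
exists E, E'; split => //; apply/disjoints_subset => z Ez /E'E.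
exact.
Qed.

(** In a compact Hausdorff space the neighborhoods of the diagonal form the compatible uniformity.
    Constructing it makes statements about [is_entourage] usable: some entourage fits into any given
    neighborhood. *)
Definition diagonal_nbhs : set_system (X * X) :=
  [set u | forall x : X, nbhs (x, x) u].

Lemma diagonal_nbhs_imply (F U : set X) : closed F -> open U -> F `<=` U ->
  diagonal_nbhs [set xy | F xy.1 -> U xy.2].
Proof.
move=> cF oU FU x; have [Fx|nFx] := EM (F x).
  exists (setT, U); last by move=> [y z] [_ Uz] _.
  by split; [exact: filterT|apply: open_nbhs_nbhs; split=> //; exact: FU].
exists (~` F, setT); last by move=> [y z] [nFy _] /nFy.
by split; [apply: open_nbhs_nbhs; split=> //; rewrite openC|exact: filterT].
Qed.

Lemma diagonal_nbhs_inv u : diagonal_nbhs u -> diagonal_nbhs (u^-1)%relation.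
Proof.
move=> du x; have [[U V] /= [xU xV] UVu] := du x.
by exists (V, U) => // -[y z] [Vy Uz]; exact: (UVu (z, y)).
Qed.

Lemma diagonal_nbhs_filter : Filter diagonal_nbhs.
Proof.
split.
- by move=> x; exact: filterT.
- by move=> u v du dv x; exact: filterI.
- by move=> u v uv du x; exact: filterS uv (du x).
Qed.

(* A cluster point (x, y) of the sets (v \; v) `\` u would satisfy x <> y, since
   u is a neighborhood of (x, x); but then some v separates x from y. *)
Lemma diagonal_nbhs_split u : diagonal_nbhs u ->
  exists2 v, diagonal_nbhs v & (v \; v `<=` u)%relation.
Proof.
move=> du; apply: contrapT => nv.
have FF := diagonal_nbhs_filter.
pose S v := ((v \; v)%relation : set (X * X)) `\` u.
pose F := filter_from diagonal_nbhs S.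
have PF : ProperFilter F.
  apply: filter_from_proper.
    apply: filter_from_filter; first by exists setT; exact: (@filterT _ _ FF).
    move=> v w dv dw; exists (v `&` w); first exact: (@filterI _ _ FF).
    by move=> xy [[z [v1 w1] [v2 w2]] nu]; split; split=> //; exists z.
  move=> v dv; apply/set0P/eqP => S0; apply: nv; exists v => // xy vxy.
  by apply: contrapT => nu; suff : S v xy by rewrite S0.
have cptXX : compact ([set: X] `*` [set: X]) by exact: compact_setX.
have [|[x y] [_ clxy]] := cptXX F PF.
  by exists setT; [exact: (@filterT _ _ FF)|move=> xy _; split].
have FS v : diagonal_nbhs v -> F (S v) by move=> dv; exists v.
have [xy|xy] := EM (x = y).
  have : nbhs (x, y) u by rewrite -xy; exact: du.
  by move=> /(clxy _ _ (FS setT (@filterT _ _ FF)))[z [[_ nu] /nu]].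
have [E [E' [cE cE' xE yE' EE']]] := closed_nbhs_sep xy.
have [D [cD xD DE]] := closed_nbhs_in (nbhs_interior xE).
have [D' [cD' yD' DE']] := closed_nbhs_in (nbhs_interior yE').
pose v := [set ab | D ab.1 -> E° ab.2] `&`
  ([set ab | D' ab.1 -> E'° ab.2]^-1)%relation.
have dv : diagonal_nbhs v.
  apply: (@filterI _ _ FF); last apply: diagonal_nbhs_inv;
    by apply: diagonal_nbhs_imply => //; exact: open_interior.
have : nbhs (x, y) (D `*` D') by exists (D, D').
move=> /(clxy _ _ (FS v dv))[[a b] [[[z /= [Ez _] [_ E'z]] _] [/= Da D'b]]].
suff : (E `&` E') z by rewrite EE'.
by split; apply: interior_subset; [exact: Ez|exact: E'z].
Qed.

Lemma diagonal_nbhs_compatible : @compatible_uniformity X diagonal_nbhs.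
Proof.
split.
- exact: diagonal_nbhs_filter.
- move=> u du [x y] xy; rewrite (xy : x = y).
  exact: nbhs_singleton.
- exact: diagonal_nbhs_inv.
- exact: diagonal_nbhs_split.
- apply/funext => x; rewrite nbhs_E; apply/seteqP; split=> U.
    move=> xU; have [E [cE xE EU]] := closed_nbhs_in (nbhs_interior xU).
    exists [set yz | E yz.1 -> U° yz.2].
      by apply: diagonal_nbhs_imply => //; exact: open_interior.
    move=> y; rewrite -in_setE mem_xsection in_setE /= => EUy.
    by apply: interior_subset; apply: EUy; exact: nbhs_singleton.
  move=> [u du uU]; have [[V W] /= [xV xW] VWu] := du x.
  apply: filterS xW => y Wy; apply: uU.
  rewrite -in_setE mem_xsection in_setE; apply: VWu; split=> //=.
  exact: nbhs_singleton.
Qed.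

Lemma entourage_in_nbhs (a : X) (U : set X) : nbhs a U ->
  exists2 u, is_entourage u & forall x, u (a, x) -> U x.
Proof.
have E := diagonal_nbhs_compatible.
have : @nbhs X X = nbhs_ diagonal_nbhs by case: E.
move=> ->; rewrite nbhs_E => -[u eu uU].
exists u; first by exists diagonal_nbhs.
by move=> x ux; apply: uU; rewrite -in_setE mem_xsection in_setE.
Qed.

End CompactSpace.

(** * Compactness: accumulation points, cluster points, subspaces *)

Lemma compact_accumulation (X : topologicalType) (I : Type) (f : I -> X)
    (A : set I) : compact [set: X] -> infinite_set A ->
  exists x : X, forall U, nbhs x U -> infinite_set [set i | A i /\ U (f i)].
Proof.
move=> cptX infA.
(* [F] is the image under [f] of the cofinite filter on [A]; its cluster points are the required
   accumulation points. *)
pose F := [set S | finite_set [set i | A i /\ ~ S (f i)]].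
have FF : ProperFilter F.
  split.
    by move=> F0; apply: infA; apply: sub_finite_set F0 => i Ai; split.
  split.
  - by rewrite /F /=; apply: sub_finite_set (finite_set0 _) => i [].
  - move=> S T FS FT; have := FS; rewrite /F /= => FS'.
    have /sub_finite_set : finite_set ([set i | A i /\ ~ S (f i)] `|`
        [set i | A i /\ ~ T (f i)]) by rewrite finite_setU.
    apply => i [Ai /not_andP[]]; by [left|right].
  - by move=> S T ST; apply: sub_finite_set => i [Ai nT]; split=> // /ST.
have [x [_ xF]] := cptX F FF filterT.
exists x => U xU finU.
have FU : F (~` U).
  by apply: sub_finite_set finU => i [Ai] /= /contrapT.
by have [y []] := xF _ _ FU xU.
Qed.

(** If every [closure B] met [K], these traces would generate a proper filter, and its cluster point
    in [K] would be a cluster point of [F]. *)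
Lemma compact_not_cluster (X : topologicalType) (K : set X) (F : set_system X) :
  Filter F -> compact K -> K `&` cluster F = set0 ->
  exists2 B, F B & closure B `&` K = set0.
Proof.
move=> FF cptK KF; apply: contrapT => noB.
pose G := filter_from F (fun B => closure B `&` K).
have GF : ProperFilter G.
  apply: filter_from_proper.
    apply: filter_from_filter; first by exists setT; exact: filterT.
    move=> B B' FB FB'; exists (B `&` B'); first exact: filterI.
    by move=> x [/closureI[xB xB'] Kx].
  move=> B FB; apply/set0P/eqP => B0; apply: noB; by exists B.
have [|x [Kx xG]] := cptK G GF.
  by exists setT; [exact: filterT|move=> x []].
suff: (K `&` cluster F) x by rewrite KF.
split=> //; rewrite clusterE => B FB.
have : G (closure B) by exists B => // y [].
move: xG; rewrite clusterE => /[apply].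
by rewrite -(closure_id _).1 //; exact: closed_closure.
Qed.

Lemma compact_val_preimage (X : topologicalType) (A K : set X) :
  compact K -> K `<=` A -> compact (set_val @^-1` K : set A).
Proof.
move=> cptK KA F FF FK.
have [|x [Kx xF]] := cptK (set_val @ F) _ _; first exact: FK.
exists (SigSub (mem_set (KA x Kx))); split=> // S B FS.
move=> [_ [[U oU <-] /= Ux UB]].
have FS' : (set_val @ F) (set_val @` S).
  by apply: (@filterS _ F _ S) FS => y Sy; exists y.
have [_ [[y Sy <-] Uy]] := xF _ _ FS' (open_nbhs_nbhs (conj oU Ux)).
by exists y; split=> //; exact: UB.
Qed.

Lemma compact_set_type (X : topologicalType) (A : set X) :
  compact [set: X] -> closed A -> compact [set: A].
Proof.
move=> cptX cA; rewrite (_ : setT = set_val @^-1` A); last first.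
  by apply/seteqP; split=> // x _; exact: (set_mem (valP x)).
by apply: compact_val_preimage => //; exact: subclosed_compact cptX _.
Qed.

Lemma compact_val_image (X : topologicalType) (A : set X) (K : set A) :
  compact K -> compact (set_val @` K).
Proof.
apply: continuous_compact; apply: continuous_subspaceT.
exact: initial_continuous.
Qed.

(** The form of separation suited to glued spaces, whose topology is described by closed sets. *)
Lemma hausdorff_closed_cover (T : topologicalType) :
  (forall x y : T, x <> y -> exists B B', [/\ closed B, closed B', ~ B x, ~ B' y
    & forall z, B z \/ B' z]) -> hausdorff_space T.
Proof.
move=> sep; rewrite open_hausdorff => x y /eqP/sep[B [B' [cB cB' Bx B'y BB']]].
exists (~` B, ~` B'); first by rewrite !inE.
split=> /=; try by rewrite openC.
by apply/eqP/seteqP; split=> // z [Bz B'z]; case: (BB' z).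
Qed.

(** * From a notion of nearness to a perspective compactification *)

(** [N h U] stands for: h moves chosen base points into [U]. In the compactification built from it,
    [near_act] gives continuity of the action, [near_meet] Hausdorffness, [near_mulr] perspectivity
    and [near_acc] compactness. *)
Record nearness (H : groupType) (X : topologicalType) (rho : action H X)
    (C : set X) (N : H -> set X -> Prop) : Prop := Nearness {
  near_mono : forall h U U', U `<=` U' -> N h U -> N h U';
  near_act : forall g h U, N h U -> N (g * h)%g (rho g @` U);
  near_meet : forall h U U', N h U -> N h U' -> U `&` U' !=set0;
  near_mulr : forall E E' f, closed E -> closed E' -> E `&` E' = set0 ->
    finite_set [set h | N h E /\ N (h * f)%g E'];
  near_acc : forall A, infinite_set A -> exists2 c, C c &
    forall U, nbhs c U -> infinite_set [set h | A h /\ N h U]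
}.

(** * Limit sets in X of subsets of H *)

Section NearnessEPers.
Variables (H : groupType) (X : topologicalType) (rho : action H X).
Variables (C : set X) (N : H -> set X -> Prop).
Hypotheses (cptX : compact [set: X]) (hsdfX : hausdorff_space X).
Hypotheses (clC : closed C) (Cact : forall h x, C x -> C (rho h x)).
Hypothesis NP : nearness rho C N.

Definition limit_set (A : set H) : set X :=
  [set x | forall U, nbhs x U -> infinite_set [set h | A h /\ N h U]].

Lemma not_limit_set A x : ~ limit_set A x ->
  exists2 U, nbhs x U & finite_set [set h | A h /\ N h U].
Proof.
move=> nxA; apply: contrapT => nU; apply: nxA => U xU fU; apply: nU.
by exists U.
Qed.

Lemma limit_setS A B : A `<=` B -> limit_set A `<=` limit_set B.
Proof.
move=> AB x xA U /xA; apply: contra_not; apply: sub_finite_set => h [/AB].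
by split.
Qed.

Lemma limit_set_finite A : finite_set A -> limit_set A = set0.
Proof.
move=> finA; apply/seteqP; split=> // x /(_ setT filterT); apply.
by apply: sub_finite_set finA => h [].
Qed.

Lemma limit_setU A B : limit_set (A `|` B) = limit_set A `|` limit_set B.
Proof.
apply/seteqP; split=> x; last first.
  by case; apply: limit_setS => h; [left|right].
move=> xAB; have [?|/not_limit_set[U xU fU]] := pselect (limit_set A x).
  by left.
have [?|/not_limit_set[V xV fV]] := pselect (limit_set B x); first by right.
exfalso.
have := xAB _ (filterI xU xV); apply.
have : finite_set ([set h | A h /\ N h U] `|` [set h | B h /\ N h V]).
  by rewrite finite_setU.
apply: sub_finite_set => h [[Ah|Bh] NUV]; [left|right]; split=> //;
  by apply: (near_mono NP) NUV => y [].
Qed.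

Lemma closed_limit_set A : closed (limit_set A).
Proof.
move=> x clx U xU.
have [y [yA yU]] := clx _ (nbhs_interior xU).
exact: yA.
Qed.

Lemma limit_set_neq0 A : infinite_set A -> (C `&` limit_set A) !=set0.
Proof. by move=> /(near_acc NP)[c Cc cA]; exists c. Qed.

Lemma limit_set_act g A x : limit_set A x ->
  limit_set [set (g * h)%g | h in A] (rho g x).
Proof.
move=> xA U xU; have /xA : nbhs x (rho g @^-1` U).
  exact: act_continuous.
apply: contra_not => fin.
have : finite_set ((fun h => (g * h)%g) @^-1`
    [set k | [set (g * h)%g | h in A] k /\ N k U]).
  by apply: finite_preimage fin => h k _ _ /mulgI.
apply: sub_finite_set => h [Ah NU]; split; first by exists h.
by apply: (near_mono NP) (near_act NP g NU) => _ [y Uy <-].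
Qed.

(** Suppose x is a limit of A f but not of A. Then infinitely many h have h f near [E] but h not
    near [V]. Their accumulation point c is not in [E], since otherwise [U] would be a neighborhood
    of c; but off [E], a closed neighborhood [E'] of c disjoint from [E] contradicts [near_mulr]. *)
Lemma limit_set_mulr_sub f A :
  limit_set [set (h * f)%g | h in A] `<=` limit_set A.
Proof.
move=> x xAf; apply: contrapT => /not_limit_set[V xV fV].
have [U [oU xU UV]] : exists U, [/\ open U, U x & U `<=` V].
  exists V°; split; [exact: open_interior|exact: xV|exact: interior_subset].
have [|E [cE xE EU]] := @closed_nbhs_in _ cptX hsdfX x U.
  exact: open_nbhs_nbhs.
pose B := [set h | A h /\ N (h * f)%g E] `\` [set h | A h /\ N h V].
have infB : infinite_set B.
  move=> finB; apply: (xAf _ xE).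
  have : finite_set ((fun h => (h * f^-1)%g) @^-1`
     (B `|` [set h | A h /\ N h V])).
    apply: finite_preimage; first by move=> h k _ _ /mulIg.
    by rewrite finite_setU.
  apply: sub_finite_set => _ [[h Ah <-] NE] /=.
  rewrite mulgK /B; have [NV|nV] := pselect (N h V); first by right.
  by left; split=> // -[].
have [c _ cB] := near_acc NP infB.
have [Ec|nEc] := pselect (E c).
  apply: (cB U); first by apply: open_nbhs_nbhs; split=> //; exact: EU.
  apply: sub_finite_set (finite_set0 _) => h [[[Ah _] nN]] NU.
  by apply: nN; split=> //; apply: (near_mono NP) NU.
have /(closed_nbhs_in cptX hsdfX)[E' [cE' cE'c E'E]] : nbhs c (~` E).
  by apply: open_nbhs_nbhs; split=> //; rewrite openC.
apply: (cB _ cE'c).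
have E'E0 : E' `&` E = set0 by apply/disjoints_subset.
apply: sub_finite_set (near_mulr NP f cE' cE E'E0) => h [[[_ NE] _] NE'].
by split.
Qed.

Lemma limit_set_mulr f A :
  limit_set [set (h * f)%g | h in A] = limit_set A.
Proof.
apply/seteqP; split; first exact: limit_set_mulr_sub.
have E : A = [set (h * f^-1)%g | h in [set (h * f)%g | h in A]].
  apply/seteqP; split=> [h Ah|_ [_ [h Ah <-] <-]]; last by rewrite mulgK.
  by exists (h * f)%g; rewrite ?mulgK//; exists h.
rewrite {1}E; exact: limit_set_mulr_sub.
Qed.

(** Take for [A] the elements not near a closed neighborhood of x; by [near_meet], the others are
    not near a disjoint neighborhood of y. *)
Lemma limit_set_sep x y : x <> y ->
  exists A, ~ limit_set A x /\ ~ limit_set (~` A) y.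
Proof.
move=> /(closed_nbhs_sep cptX hsdfX)[E [E' [cE cE' xE yE' EE']]].
exists (~` [set h | N h E]); rewrite setCK; split.
  by move=> /(_ _ xE); apply; apply: sub_finite_set (finite_set0 _) => h [].
move=> /(_ _ yE'); apply; apply: sub_finite_set (finite_set0 _) => h [NE NE'].
by have [z] := near_meet NP NE NE'; rewrite EE'.
Qed.

(** * The compactification of H by C *)

Lemma closed_val_preimage (B : set X) : closed B ->
  closed (set_val @^-1` B : set C).
Proof. apply: closed_preimage_continuous; exact: initial_continuous. Qed.

Let bd_map (A : set (discrete_topology H)) : set C := set_val @^-1` limit_set A.

Let bd0 : bd_map set0 = set0.
Proof. by rewrite /bd_map limit_set_finite ?preimage_set0. Qed.

Let bdU A B : closed A -> closed B -> bd_map (A `|` B) = bd_map A `|` bd_map B.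
Proof. by move=> _ _; rewrite /bd_map limit_setU preimage_setU. Qed.

Let bd_closed A : closed A -> closed (bd_map A).
Proof. by move=> _; apply: closed_val_preimage; exact: closed_limit_set. Qed.

Definition limit_gluing : gluing_map (discrete_topology H) C :=
  GluingMap bd0 bdU bd_closed.

Local Notation lglue := (Defs.glue limit_gluing).

Let eta (h : H) (c : C) : C := SigSub (mem_set (Cact h (set_mem (valP c)))).

Let eta1 c : eta 1%g c = c.
Proof. by apply: val_inj => /=; rewrite act1. Qed.

Let etaM g h c : eta (g * h)%g c = eta g (eta h c).
Proof. by apply: val_inj => /=; rewrite actM. Qed.

Let eta_continuous g : continuous (eta g).
Proof.
apply: continuous_comp_initial => c.
have vc : continuous (set_val : C -> X) by exact: initial_continuous.
exact: (continuous_comp (vc c) (@act_continuous _ _ rho g _)).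
Qed.

Definition sub_action : action H C :=
  @Action H C eta eta1 etaM eta_continuous.

(** An infinite subset of H has a limit in C, so a closed set avoiding C contains only finitely many
    elements of H. *)
Lemma limit_glue_finite (B : set lglue) : closed B ->
  inr @^-1` B = set0 -> finite_set B.
Proof.
rewrite closed_glueE => -[_ _ B3] B0.
have finV : finite_set (inl @^-1` B : set H).
  apply: contrapT => /limit_set_neq0[x [Cx xB]].
  suff : (inr @^-1` B : set C) (SigSub (mem_set Cx)) by rewrite B0.
  exact: B3.
apply: sub_finite_set (finite_image (inl : H -> lglue) finV).
move=> [h|c] Bx; first by exists h.
suff : (inr @^-1` B : set C) c by rewrite B0.
exact: Bx.
Qed.

Lemma inr_continuous : continuous (inr : C -> lglue).
Proof.
by apply: continuous_closed_preimage => B; rewrite closed_glueE => -[].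
Qed.

(** A filter without cluster points in the compact C contains a set whose closure avoids C; that
    closure is finite, so the filter clusters there. *)
Lemma limit_glue_compact : compact [set: lglue].
Proof.
have cptC : compact [set: C] by exact: compact_set_type.
have cptK : compact [set (inr c : lglue) | c in [set: C]].
  apply: continuous_compact => //; apply: continuous_subspaceT.
  exact: inr_continuous.
move=> F FF _; apply: contrapT => F0.
have [|B FB clB] := compact_not_cluster _ cptK (F := F).
  by apply/seteqP; split=> // x [_ Fx]; apply: F0; exists x.
have finB : finite_set (closure B).
  apply: limit_glue_finite; first exact: closed_closure.
  apply/seteqP; split=> // c Bc.
  suff : (closure B `&` [set (inr c : lglue) | c in [set: C]]) (inr c).
    by rewrite clB.
  by split=> //; exists c.
have [|x [_ Fx]] := finite_compact finB FF; last by apply: F0; exists x.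
by apply: filterS FB; exact: subset_closure.
Qed.

Lemma closed_inl1 h : closed [set (inl h : lglue)].
Proof.
rewrite closed_glueE; split; first exact: discrete_closed.
- rewrite (_ : inr @^-1` _ = set0); first exact: closed0.
  by apply/seteqP; split.
- move=> c; rewrite /= /bd_map /= limit_set_finite //.
  rewrite (_ : inl @^-1` _ = [set h]) //.
  by apply/seteqP; split=> k /= => [[]|->].
Qed.

Lemma closed_inl1C h : closed (~` [set (inl h : lglue)]).
Proof.
rewrite closed_glueE; split; first exact: discrete_closed.
- rewrite (_ : inr @^-1` _ = setT); first exact: closedT.
  by apply/seteqP; split.
- by [].
Qed.

Lemma limit_glue_hausdorff : hausdorff_space lglue.
Proof.
apply: hausdorff_closed_cover => -[h|c] [k|d] xy.
- exists (~` [set (inl h : lglue)]), [set (inl h : lglue)].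
  split; [exact: closed_inl1C|exact: closed_inl1|by apply|exact/nesym|].
  by move=> z; rewrite orC; exact: EM.
- exists (~` [set (inl h : lglue)]), [set (inl h : lglue)].
  split; [exact: closed_inl1C|exact: closed_inl1|by apply|exact/nesym|].
  by move=> z; rewrite orC; exact: EM.
- exists [set (inl k : lglue)], (~` [set (inl k : lglue)]).
  split; [exact: closed_inl1|exact: closed_inl1C|exact: xy|by apply|].
  by move=> z; exact: EM.
have {}xy : val c <> val d by move/val_inj => cd; apply: xy; rewrite cd.
have [A [Ac Ad]] := limit_set_sep xy.
have [E [E' [cE cE' xE yE' EE']]] := closed_nbhs_sep cptX hsdfX xy.
(* Adding [limit_set A] on the C side makes the set closed; it still avoids c, which is interior to
   [E] and not a limit of [A]. *)
pose B A E (z : lglue) := match z with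
  | inl h => A h | inr c => (limit_set A `|` ~` E°) (val c) end.
have clB A' E0 : closed (B A' E0).
  rewrite closed_glueE; split; first exact: discrete_closed.
    apply: (@closed_val_preimage (limit_set A' `|` ~` E0°)); apply: closedU.
      exact: closed_limit_set.
    by rewrite closedC; exact: open_interior.
  by move=> e Ae; left.
exists (B A E), (B (~` A) E'); split=> //.
- by case.
- by case.
- case=> [h|e] /=; first exact: EM.
  have [Ee|nEe] := pselect (E° (val e)); last by left; right.
  right; right => E'e; suff : (E `&` E') (val e) by rewrite EE'.
  by split; exact: nbhs_singleton.
Qed.

Lemma limit_glue_act_continuous h : continuous
  (glue_act sub_action h : lglue -> lglue).
Proof.
apply: continuous_closed_preimage => B; rewrite !closed_glueE => -[_ B2 B3].
split; first exact: discrete_closed.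
  exact: (closed_preimage_continuous (@act_continuous _ _ sub_action h) B2).
move=> c cB; apply: B3.
have {}cB : limit_set (inl @^-1` (glue_act sub_action h @^-1` B)) (val c).
  exact: cB.
change (limit_set (inl @^-1` B) (rho h (val c))).
apply: (@limit_setS [set (h * k)%g | k in
  inl @^-1` (glue_act sub_action h @^-1` B)]).
  by move=> _ [k Bk <-]; exact: Bk.
exact: limit_set_act.
Qed.

(** It suffices to treat pairs f, f'. If h f and h f' were far apart for infinitely many h, these h
    would have a limit x in C; right multiplication does not change limits, so some such h would
    have both h f and h f' near x, hence near each other. *)
Lemma limit_perspective (u : set (lglue * lglue)) :
  is_entourage u -> forall F : set H, finite_set F ->
  finite_set [set h | ~ small u (inl @` [set (h * k)%g | k in F])].
Proof.
move=> [ent [entF ent_diag ent_inv ent_split entE] eu] F finF.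
pose bad (ff : H * H) := [set h | ~ u (inl (h * ff.1)%g, inl (h * ff.2)%g)].
suff fin ff : finite_set (bad ff).
  have : finite_set (\bigcup_(ff in F `*` F) bad ff).
    by apply: bigcup_finite => // ; exact: finite_setX.
  apply: sub_finite_set => h nsm; apply: contrapT => nbad; apply: nsm.
  move=> [_ _] [/= [_ [f Ff <-] <-] [_ [f' Ff' <-] <-]] /=.
  by apply: contrapT => nu; apply: nbad; exists (f, f').
case: ff => f f'; apply: contrapT => inf.
have [x [Cx xbad]] := limit_set_neq0 inf.
pose c : C := SigSub (mem_set Cx).
have [v ev vu] := ent_split u eu.
pose w := v `&` (v^-1)%relation.
have ew : ent w by apply: filterI => //; exact: ent_inv.
pose U : set lglue := [set y | w (inr c, y)].
have cU : nbhs (inr c : lglue) U.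
  rewrite entE nbhs_E; exists w => // y.
  by rewrite -in_setE mem_xsection in_setE.
have esc A (g : H) : (forall h, A h -> ~ U° (inl (h * g)%g)) -> ~ limit_set A x.
  move=> AU xA.
  have : closed (~` U°) by rewrite closedC; exact: open_interior.
  rewrite closed_glueE => -[_ _ U3].
  suff : (~` U°) (inr c) by apply; exact: cU.
  apply: U3; change (limit_set (inl @^-1` (~` U°)) x).
  rewrite -(limit_set_mulr g) in xA.
  by move: xA; apply: limit_setS => _ [h Ah <-]; exact: AU.
(* For h in [B], badness forces h f' out of [U]; on the other half h f is outside its interior. So
   [esc] excludes x from the limits of both halves. *)
pose B := [set h | bad (f, f') h /\ U° (inl (h * f)%g)].
have : limit_set (B `|` [set h | bad (f, f') h /\ ~ U° (inl (h * f)%g)]) x.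
  move: xbad; apply: limit_setS => h bh.
  by have [?|?] := pselect (U° (inl (h * f)%g)); [left|right].
rewrite limit_setU => -[xB|]; last by apply: (esc _ f) => h [].
apply: (esc B f') xB => h [bh Uf Uf']; apply: bh.
have [_ wf] := interior_subset Uf; have [wf' _] := interior_subset Uf'.
by apply: vu => /=; exists (inr c).
Qed.

Definition limit_EPers : EPers H := {|
  ep_space := C;
  ep_bd := limit_gluing;
  ep_act := sub_action;
  ep_compact := limit_glue_compact;
  ep_hausdorff := limit_glue_hausdorff;
  ep_act_continuous := limit_glue_act_continuous;
  ep_perspective := limit_perspective |}.

End NearnessEPers.

(** * Nearness at a parabolic point *)

Lemma infinite_injection (T : Type) (A : set T) : infinite_set A ->
  exists2 f : nat -> T, injective f & forall n, A (f n).
Proof.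
move=> /infiniteP/card_leP[f].
exists (fun n => val (f (SigSub (mem_set (I : [set: nat] n))))) => [m n|n].
  move/val_inj => E; have := @inj _ _ _ f _ _ (mem_set I) (mem_set I) E.
  by move/(congr1 val).
exact: (set_mem (valP (f _))).
Qed.

Definition nat_directed : directed :=
  @Directed nat (fun m n => (m <= n)%N) (inhabits 0%N) leqnn
    (fun d e f h => leq_trans h) (fun d e => ex_intro2 _ _ (maxn d e)
      (leq_maxl d e) (leq_maxr d e)).

(** The convergence property for an injective sequence in [A], phrased with infinite sets instead of
    subnets. The pair a, b is fixed before [K] and [U]. *)
Lemma convergence_collapse (H : groupType) (X : topologicalType)
    (rho : action H X) (A : set H) :
  compact [set: X] -> hausdorff_space X -> convergence_property rho ->
  infinite_set A ->
  exists a b : X, forall K U, compact K -> K `<=` [set~ b] -> nbhs a U ->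
    infinite_set [set h | A h /\ rho h @` K `<=` U].
Proof.
move=> cptX hsdfX conv /infinite_injection[f finj fA].
have [|E [j [jcof [a [b ab]]]]] := conv nat_directed f.
  by split=> // -[d /(_ d.+1)] /=; rewrite ltnn.
exists a, b => K U cptK Kb aU fin.
have [u entu uU] := entourage_in_nbhs cptX hsdfX aU.
have [d0 d0P] := ab K cptK Kb u entu.
have : finite_set (f @^-1` [set h | A h /\ rho h @` K `<=` U]).
  by apply: finite_preimage fin => m n _ _ /finj.
move=> /finite_seqP[s sE].
(* The successor places the subnet strictly beyond every index in [s]. *)
have [e0 e0P] := jcof (\max_(n <- s) n).+1.
have [e d0e e0e] := dir_upper d0 e0.
have : (f @^-1` [set h | A h /\ rho h @` K `<=` U]) (j e).
  split; first exact: fA.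
  by move=> _ [x Kx <-]; apply: uU; exact: d0P.
rewrite sE /= => js.
have := e0P _ e0e; rewrite /= ltnNge.
by rewrite (leq_bigmax_seq (F := fun n => n)).
Qed.

Section ParabolicFiber.
Variables (G : groupType) (X Z : topologicalType).
Hypotheses (cptX : compact [set: X]) (hsdfX : hausdorff_space X).
Hypothesis hsdfZ : hausdorff_space Z.
Variables (psi : action G X) (phi : action G Z) (alpha : X -> Z).
Hypotheses (alpha_cont : continuous alpha)
  (alpha_surj : forall z, exists x, alpha x = z)
  (alpha_equiv : forall g x, alpha (psi g x) = phi g (alpha x)).
Variable p : Z.
Hypotheses (pP : bounded_parabolic phi p)
  (pconv : convergence_property (stab_restrict phi p psi)).

Local Notation H := (stab phi p).
Local Notation rho := (stab_restrict phi p psi).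
Local Notation C := (alpha @^-1` [set p]).

Lemma closed_fiber : closed C.
Proof.
apply: closed_preimage_continuous => //.
by apply: accessible_closed_set1; exact: hausdorff_accessible.
Qed.

Lemma alpha_rho (h : H) x : alpha (rho h x) = phi (\val h) (alpha x).
Proof. exact: alpha_equiv. Qed.

Lemma fiber_act (h : H) x : C x -> C (rho h x).
Proof. by move=> /= Cx; rewrite alpha_rho Cx stabP. Qed.

Lemma fiber_actV (h : H) x : C (rho h x) -> C x.
Proof. by move=> /(fiber_act h^-1%g); rewrite actK. Qed.

(** Proper discontinuity on Z - {p}, pulled back along [alpha]: the image of [L] is compact and
    avoids p. *)
Lemma finite_return (L : set X) : compact L -> L `&` C = set0 ->
  finite_set [set h : H | exists2 x, L x & L (rho h x)].
Proof.
move=> cptL LC.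
have Lp x : L x -> alpha x <> p.
  by move=> Lx xp; suff : (L `&` C) x by rewrite LC.
have cptK : compact (set_val @^-1` (alpha @` L) : set (puncture p)).
  apply: compact_val_preimage.
    by apply: continuous_compact => //; exact: continuous_subspaceT.
  by move=> _ [x Lx <-]; exact: Lp.
apply: sub_finite_set (pP.1 _ cptK) => h [x Lx Lhx].
exists (mk_puncture (Lp _ Lhx)); split; last by exists (rho h x).
exists (mk_puncture (Lp _ Lx)); first by exists x.
by apply: val_inj; rewrite /= -alpha_rho.
Qed.

(* If the repelling point of a collapsing sequence lies outside C, then the
   invariant set C itself collapses, so that it is a point and proper
   discontinuity outside C takes over. *)
Lemma finite_straddle (L E E' : set X) : compact L -> L `&` C = set0 ->
  closed E -> closed E' -> E `&` E' = set0 ->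
  finite_set [set h : H | (exists2 x, L x & E (rho h x)) /\
                          (exists2 x, L x & E' (rho h x))].
Proof.
move=> cptL LC.
pose A E1 E2 := [set h : H | (exists2 x, L x & E1 (rho h x)) /\
                             (exists2 x, L x & E2 (rho h x))].
have AC E1 E2 : A E1 E2 = A E2 E1.
  by apply/seteqP; split=> h [].
move=> cE cE' EE'; apply: contrapT; rewrite -/(A E E') => infA.
have [a [b ab]] := convergence_collapse cptX hsdfX pconv infA.
(* At most one of the disjoint sets contains a, and the situation is symmetric in them. *)
wlog nEa : E E' cE cE' EE' infA ab / ~ E a => [wl|].
  have [Ea|] := pselect (E a); last by move=> ?; apply: (wl E E').
  apply: (wl E' E); rewrite 1?(AC E' E) 1?setIC //.
  by move=> E'a; suff : (E `&` E') a by rewrite EE'.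
have aE : nbhs a (~` E) by apply: open_nbhs_nbhs; split=> //; rewrite openC.
have [Lb|nLb] := pselect (L b); last first.
  have [|h [[[x Lx Ehx] _] hL]] := infinite_setN0 (ab L (~` E) cptL _ aE).
    by move=> x Lx xb; apply: nLb; rewrite -xb.
  by apply: (hL (rho h x)) => //; exists x.
have Ca c : C c -> c = a.
  move=> Cc; apply: contrapT => ca.
  have aU : nbhs a (~` [set c]).
    apply: open_nbhs_nbhs; split; last exact/nesym.
    rewrite openC; apply: accessible_closed_set1; exact: hausdorff_accessible.
  have cptC : compact C.
    by apply: subclosed_compact cptX _; first exact: closed_fiber.
  have [|h [_ hC]] := infinite_setN0 (ab C _ cptC _ aU).
    move=> x Cx xb; suff : (L `&` C) b by rewrite LC.
    by split=> //; rewrite -xb.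
  apply: (hC (rho h (rho h^-1%g c))); last by rewrite /= actVK.
  by exists (rho h^-1%g c) => //; exact: fiber_act.
(* C is contained in {a}, so [E] avoids C as well, and each h in question moves a point of [L] into
   [E]. *)
apply: infA; apply: sub_finite_set (finite_return (L := L `|` E) _ _).
- by move=> h [[x Lx Ex] _]; exists x; [left|right].
- by apply: compactU => //; exact: subclosed_compact cE cptX _.
- rewrite setIUl LC set0U; apply/seteqP; split=> // x [Ex /Ca xa].
  by apply: nEa; rewrite -xa.
Qed.

(** * Nearness from an orbit outside the fiber *)

Section PunctureNonempty.
Variable x0 : X.
Hypothesis x0C : ~ C x0.

Definition orbit_near (h : H) (U : set X) : Prop := U (rho h x0).

(** [near_mulr] is [finite_straddle] for the points x0 and f x0. For [near_acc], an accumulation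
    point outside C would have a compact neighborhood outside C into which infinitely many h move
    x0, against [finite_return]. *)
Lemma orbit_nearness : nearness rho C orbit_near.
Proof.
split.
- by move=> h U U' UU' /UU'.
- by move=> g h U NU; exists (rho h x0) => //; rewrite -actM.
- by move=> h U U' NU NU'; exists (rho h x0).
- move=> E E' f cE cE' EE'.
  have : finite_set [set h : H |
      (exists2 x, [set x0; rho f x0] x & E (rho h x)) /\
      (exists2 x, [set x0; rho f x0] x & E' (rho h x))].
    apply: finite_straddle => //.
      by apply: compactU; exact: compact_set1.
    apply/seteqP; split=> // x [[->|->]] //.
    by move=> /fiber_actV.
  apply: sub_finite_set => h [Eh E'h]; split; first by exists x0 => //; left.
  by exists (rho f x0); [right|rewrite -actM].
- move=> A /(compact_accumulation (fun h => rho h x0) cptX)[x xA].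
  exists x => //; apply: contrapT => nCx.
  have /(closed_nbhs_in cptX hsdfX)[E [cE xE EC]] : nbhs x (~` C).
    by apply: open_nbhs_nbhs; split=> //; rewrite openC; exact: closed_fiber.
  apply: (xA _ xE); apply: sub_finite_set (finite_return (L := x0 |` E) _ _).
  + by move=> h [Ah Eh]; exists x0; [left|right].
  + apply: compactU; first exact: compact_set1.
    exact: subclosed_compact cE cptX _.
  + by apply/seteqP; split=> // y [[->|/EC]].
Qed.

End PunctureNonempty.

(** * Comparison of limits with the gluing on Z - {p} *)

Section Attraction.
Variable N : H -> set X -> Prop.

Definition spreading (K : set Z) : Prop :=
  [/\ compact K, ~ K p &
    forall z, z <> p -> exists (h : H) k, K k /\ phi (\val h) k = z].

(** The elements h for which h K meets S define the boundary of S in [gluing_pi]. This inclusion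
    yields continuity of the coordinate map at points of C; the converse estimate [limits_within]
    yields its closedness. *)
Definition limits_dominate : Prop := forall K S : set Z,
  spreading K -> ~ S p ->
  C `&` closure (alpha @^-1` S) `<=`
  limit_set N [set h | exists2 k, K k & S (phi (\val h) k)].

Definition limits_within : Prop := forall (K : set Z) (E : set X),
  spreading K -> closed E ->
  limit_set N [set h | exists2 k, K k & (alpha @` E) (phi (\val h) k)] `<=` E.

End Attraction.

(** Suppose only finitely many h with h [K] meeting [S] bring x0 into a neighborhood [U] of c. A
    point y over [S] close to c lies in the h-translate of the preimage of [K] for some h; either h
    x0 is in [U], or h is in [Bad], which is finite by [finite_straddle]. These finitely many
    translates form a closed set avoiding c, so y can be chosen outside them. *)
Lemma orbit_limits_dominate x0 : ~ C x0 -> limits_dominate (orbit_near x0).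
Proof.
move=> x0C K S [cptK Kp HK] Sp c [Cc Sc] U cU finU.
have [E [cE Ec EU]] := closed_nbhs_in cptX hsdfX (nbhs_interior cU).
have cK : closed (alpha @^-1` K).
  by apply: closed_preimage_continuous => //; exact: compact_closed.
have cptL : compact (alpha @^-1` K) by exact: subclosed_compact cK cptX _.
pose Bad := [set h : H | (exists2 x, (x0 |` alpha @^-1` K) x & E (rho h x)) /\
   (exists2 x, (x0 |` alpha @^-1` K) x & (~` U°) (rho h x))].
have finBad : finite_set Bad.
  apply: finite_straddle => //.
  - by apply: compactU => //; exact: compact_set1.
  - apply/seteqP; split=> // x [[->|/= Kx]] //= xp.
    by apply: Kp; rewrite -xp.
  - by rewrite closedC; exact: open_interior.
  - by apply/disjoints_subset; rewrite setCK.
pose M := \bigcup_(h in Bad `|` [set h | [set h : H | exists2 k, K k &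
  S (phi (\val h) k)] h /\ orbit_near x0 h U]) (rho h @` (alpha @^-1` K)).
have cM : closed M.
  apply: closed_bigcup; first by rewrite finite_setU.
  move=> h _; apply: compact_closed => //; apply: continuous_compact => //.
  by apply: continuous_subspaceT; exact: act_continuous.
have Mc : ~ M c.
  move=> [h _ [l Kl lc]]; apply: Kp.
  have /fiber_actV <- // : C (rho h l) by rewrite lc.
have : nbhs c (E `&` ~` M).
  by apply: filterI => //; apply: open_nbhs_nbhs; split=> //; rewrite openC.
move=> /Sc[y [/= Sy [Ey]]]; apply.
have [|h [k [Kk hk]]] := HK (alpha y).
  by move=> yp; apply: Sp; rewrite -yp.
have lk : alpha (rho h^-1%g y) = k.
  by apply: (act_inj (f := phi) (g := \val h)); rewrite -alpha_rho actVK hk.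
exists h; last by exists (rho h^-1%g y); rewrite ?actVK //= lk.
have [Ux0|nUx0] := pselect (U° (rho h x0)); last first.
  left; split.
    by exists (rho h^-1%g y); rewrite ?actVK //; right; rewrite /= lk.
  by exists x0 => //; left.
right; split; last exact: interior_subset Ux0.
by exists k; rewrite ?hk.
Qed.

(** If a limit c were outside [E], take [E'] around c disjoint from [E]. The relevant h move x0 into
    [E'] and a point over [K] into [E], so [finite_straddle] leaves only finitely many. *)
Lemma orbit_limits_within x0 : ~ C x0 -> limits_within (orbit_near x0).
Proof.
move=> x0C K E [cptK Kp _] cE c cA; apply: contrapT => nEc.
have /(closed_nbhs_in cptX hsdfX)[E' [cE' E'c E'E]] : nbhs c (~` E).
  by apply: open_nbhs_nbhs; split=> //; rewrite openC.
have cK : closed (alpha @^-1` K).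
  by apply: closed_preimage_continuous => //; exact: compact_closed.
have cptL : compact (alpha @^-1` K) by exact: subclosed_compact cK cptX _.
apply: (cA _ E'c).
apply: sub_finite_set (finite_straddle (L := x0 |` alpha @^-1` K) _ _ cE cE' _).
- move=> h [[k Kk [e Ee ek]] E'h]; split; last by exists x0 => //; left.
  exists (rho h^-1%g e); last by rewrite actVK.
  right; rewrite /= (_ : alpha _ = k) //.
  by apply: (act_inj (f := phi) (g := \val h)); rewrite -alpha_rho actVK.
- by apply: compactU => //; exact: compact_set1.
- apply/seteqP; split=> // x [[->|/= Kx]] //= xp.
  by apply: Kp; rewrite -xp.
- by rewrite setIC; apply/disjoints_subset.
Qed.

(** * The case Z = {p} *)

Section PunctureEmpty.
Hypothesis Zp : forall z, z = p.

Lemma empty_limits_dominate N : limits_dominate N.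
Proof.
move=> K S _ Sp c [_ /(_ setT filterT)[y [/= Sy _]]].
by case: Sp; rewrite -(Zp (alpha y)).
Qed.

Lemma empty_limits_within N : limits_within N.
Proof.
move=> K E [_ Kp _] _ c cA; exfalso; apply: (cA setT filterT).
apply: sub_finite_set (finite_set0 _) => h [[k Kk _] _].
by apply: Kp; rewrite -(Zp k).
Qed.

Lemma point_nearness x0 : (forall x, x = x0) ->
  nearness rho C (fun (_ : H) (U : set X) => U x0).
Proof.
move=> Xx0; split.
- by move=> _ U U' /[apply].
- by move=> g _ U Ux0; exists x0.
- by move=> _ U U' Ux0 U'x0; exists x0.
- move=> E E' _ _ _ EE'; apply: sub_finite_set (finite_set0 _) => h [Ex0 E'x0].
  by suff : (E `&` E') x0 by rewrite EE'.
- move=> A infA; exists x0; first exact: Zp.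
  move=> U /nbhs_singleton Ux0; apply: contra_not infA.
  by apply: sub_finite_set => h.
Qed.

Section ThreePoints.
Variables x1 x2 x3 : X.
Hypotheses (x12 : x1 <> x2) (x13 : x1 <> x3) (x23 : x2 <> x3).

Local Notation T := [set x1; x2; x3].

(** A collapsing sequence may fail at one point b, so only two of the three base points can be
    required; two such pairs always share a point, which gives [near_meet]. *)
Definition majority_near (h : H) (U : set X) : Prop :=
  exists x y, [/\ T x, T y, x <> y, U (rho h x) & U (rho h y)].

Let common x y x' y' : T x -> T y -> x <> y -> T x' -> T y' -> x' <> y' ->
  exists2 z, z = x \/ z = y & z = x' \/ z = y'.
Proof.
by move=> [[]|] -> [[]|] -> // _ [[]|] -> [[]|] -> // _;
  (exists x1; by tauto) || (exists x2; by tauto) || (exists x3; by tauto).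
Qed.

Lemma majority_nearness : nearness rho C majority_near.
Proof.
have finT : finite_set T by rewrite finite_setU.
split.
- by move=> h U U' UU' [x [y [Tx Ty xy /UU' Ux /UU' Uy]]]; exists x, y.
- move=> g h U [x [y [Tx Ty xy Ux Uy]]]; exists x, y.
  by split=> //; rewrite actM; [exists (rho h x)|exists (rho h y)].
- move=> h U U' [x [y [Tx Ty xy Ux Uy]]] [x' [y' [Tx' Ty' xy' Ux' Uy']]].
  have [z zxy zxy'] := common Tx Ty xy Tx' Ty' xy'.
  by exists (rho h z); split; [case: zxy|case: zxy'] => ->.
- move=> E E' f cE cE' EE'; apply: contrapT => infA.
  have [a [b ab]] := convergence_collapse cptX hsdfX pconv infA.
  pose K := (T `|` rho f @` T) `&` [set~ b].
  have cptK : compact K.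
    apply: finite_compact; apply: finite_setIl.
    by rewrite finite_setU; split=> //; exact: finite_image.
  have Kb : K `<=` [set~ b] by move=> x [].
  (* Of two distinct base points, or of their images under f, at least one differs from b and is
     collapsed to a; hence both [E] and [E'] contain a. *)
  have esc F : closed F -> (F = E \/ F = E') -> F a.
    move=> cF FE; apply: contrapT => nFa.
    have aF : nbhs a (~` F) by apply: open_nbhs_nbhs; split=> //; rewrite openC.
    have [h [[NE NE'] hK]] := infinite_setN0 (ab K _ cptK Kb aF).
    have hK' x : K x -> ~ F (rho h x) by move=> Kx; apply: hK; exists x.
    case: FE => ?; subst F.
      move: NE => [x [y [Tx Ty xy Ux Uy]]].
      have [xb|xb] := EM (x = b); last first.
        by apply: (hK' x) => //; split=> //; left.
      by apply: (hK' y) => //; split; [left|move=> yb; apply: xy; rewrite xb].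
    move: NE' => [x [y [Tx Ty xy]]]; rewrite !actM => Ux Uy.
    have [xb|xb] := EM (rho f x = b).
      apply: (hK' (rho f y)) => //; split; first by right; exists y.
      by move=> yb; apply: xy; apply: (act_inj (f := rho) (g := f)); rewrite xb.
    by apply: (hK' (rho f x)) => //; split=> //; right; exists x.
  suff : (E `&` E') a by rewrite EE'.
  by split; apply: esc => //; [left|right].
- move=> A infA; have [a [b ab]] := convergence_collapse cptX hsdfX pconv infA.
  exists a; first exact: Zp.
  move=> U aU; have cptK : compact (T `&` [set~ b]).
    by apply: finite_compact; exact: finite_setIl.
  apply: contra_not (ab _ U cptK (@subIsetr _ _ _) aU).
  apply: sub_finite_set => h [Ah hK]; split=> //.
  have hU x : T x -> x <> b -> U (rho h x).
    by move=> Tx xb; apply: hK; exists x.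
  have [x1b|x1b] := EM (x1 = b).
    exists x2, x3; split; rewrite /=; try tauto;
      by apply: hU; rewrite /= -?x1b; try tauto; exact/nesym.
  have [x2b|x2b] := EM (x2 = b).
    exists x1, x3; split; rewrite /=; try tauto;
      by apply: hU; rewrite /= -?x2b; try tauto; exact/nesym.
  by exists x1, x2; split; rewrite /=; try tauto; apply: hU; rewrite /=; tauto.
Qed.

End ThreePoints.
End PunctureEmpty.

(** An orbit outside C is used if there is one. Otherwise Z = {p} and X is a point or has three
    distinct points. A two-point X is excluded by [nondeg]: a one-ended group exchanging two points
    has the convergence property, but no perspective compactification by these two points. *)
Lemma fiber_nearness : ~ ([set: Z] #= `I_1 /\ [set: X] #= `I_2) ->
  exists N, [/\ nearness rho C N, limits_dominate N & limits_within N].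
Proof.
move=> nondeg; have [[x0 x0C]|allC] := EM (exists x0, ~ C x0).
  exists (orbit_near x0); split.
  - exact: orbit_nearness.
  - exact: orbit_limits_dominate.
  - exact: orbit_limits_within.
have Zp z : z = p.
  have [x <-] := alpha_surj z; apply: contrapT => nx; apply: allC; by exists x.
suff [N NP] : exists N, nearness rho C N.
  exists N; split=> //; first exact: empty_limits_dominate.
  exact: empty_limits_within.
have [x1 _] := alpha_surj p.
have [X1|/existsNP[x2 /nesym x12]] := EM (forall x, x = x1).
  by exists (fun _ U => U x1); exact: point_nearness.
have [X2|/existsNP[x3 /not_orP[/nesym x13 /nesym x23]]] :=
    EM (forall x, x = x1 \/ x = x2).
  exfalso; apply: nondeg; split.
    rewrite (_ : setT = [set p]); first exact: card_set1.
    by apply/seteqP; split=> // z _; exact: Zp.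
  apply/eq_cardSP; exists x1 => //.
  rewrite (_ : _ `\` _ = [set x2]); first exact: card_set1.
  apply/seteqP; split=> [x [_ xx1]|x ->]; first by case: (X2 x).
  by split=> // /esym.
by exists (majority_near x1 x2 x3); exact: majority_nearness.
Qed.

End ParabolicFiber.

(** * The coordinate maps to the glued spaces *)

Lemma closed_val_preimageP (X : topologicalType) (A : set X) (B : set A) :
  closed B -> exists2 F, closed F & B = set_val @^-1` F.
Proof.
move=> cB; have : open (~` B) by rewrite openC.
case=> U oU UB; exists (~` U); first by rewrite closedC.
by rewrite -[LHS]setCK -UB.
Qed.

Section Coordinate.
Variables (G : groupType) (X Z : topologicalType).
Hypotheses (cptX : compact [set: X]) (hsdfX : hausdorff_space X).
Hypothesis hsdfZ : hausdorff_space Z.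
Variables (psi : action G X) (phi : action G Z) (alpha : X -> Z).
Hypotheses (alpha_cont : continuous alpha)
  (alpha_surj : forall z, exists x, alpha x = z)
  (alpha_equiv : forall g x, alpha (psi g x) = phi g (alpha x)).
Variables (p q : Z) (g : G) (e : phi g p = q).
Variable N : stab phi p -> set X -> Prop.

Local Notation C := (alpha @^-1` [set p]).

Hypotheses (NP : nearness (stab_restrict phi p psi) C N)
  (Ndom : limits_dominate alpha N) (Nwithin : limits_within alpha N).
Variable K : set (puncture q).
Hypothesis KP : cocompact_by (puncture_action phi q) K.

Local Notation fbd := (gluing_transport (conj_stab e) (limit_gluing NP)).
Local Notation pc := (Defs.glue (gluing_pi (puncture_action phi q) K fbd)).

Lemma fiber_back x : alpha x = q -> C (psi g^-1%g x).
Proof. by move=> xq; rewrite /= alpha_equiv xq -e actK. Qed.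

Lemma fiber_forth x : C x -> alpha (psi g x) = q.
Proof. by move=> /= xp; rewrite alpha_equiv xp. Qed.

(** The fiber over q is moved by g^-1 into the fiber over p, because the blowup uses the same C
    along the whole orbit. *)
Definition coordinate (x : X) : pc :=
  match pselect (alpha x = q) with
  | left xq => inr (SigSub (mem_set (fiber_back xq)))
  | right xq => inl (mk_puncture xq)
  end.

Lemma coordinate_inl x (xq : alpha x <> q) :
  coordinate x = inl (mk_puncture xq).
Proof.
rewrite /coordinate; case: pselect => // xq'.
by congr inl; apply: val_inj.
Qed.

Lemma coordinate_inr x (xq : alpha x = q) :
  coordinate x = inr (SigSub (mem_set (fiber_back xq))).
Proof.
rewrite /coordinate; case: pselect => // xq'.
by congr inr; apply: val_inj.
Qed.

Lemma coordinate_fiber (c : C) : coordinate (psi g (val c)) = inr c.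
Proof.
have cq := fiber_forth (set_mem (valP c)).
by rewrite (coordinate_inr cq); congr inr; apply: val_inj; rewrite /= actK.
Qed.

Lemma coordinate_eq_inr x (c : C) : coordinate x = inr c -> x = psi g (val c).
Proof.
rewrite /coordinate; case: pselect => // xq -[<-] /=.
by rewrite actVK.
Qed.

Lemma coordinate_eq_inl x z : coordinate x = inl z -> alpha x = val z.
Proof. by rewrite /coordinate; case: pselect => // xq -[<-]. Qed.

Lemma coordinate_surj y : exists x, coordinate x = y.
Proof.
case: y => [z|c]; last by exists (psi g (val c)); exact: coordinate_fiber.
have [x xz] := alpha_surj (val z).
have xq : alpha x <> q by rewrite xz; exact: punctureP.
by exists x; rewrite (coordinate_inl xq); congr inl; apply: val_inj.
Qed.

Let K' : set Z := [set phi g^-1%g (val k) | k in K].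

Lemma spreading_transport : spreading phi p K'.
Proof.
case: KP => cptK HK; split.
- rewrite (_ : K' = phi g^-1%g @` (set_val @` K)); last first.
    apply/seteqP; split=> [_ [k Kk <-]|_ [_ [k Kk <-] <-]]; last by exists k.
    by exists (val k) => //; exists k.
  apply: continuous_compact; last exact: compact_val_image.
  by apply: continuous_subspaceT; exact: act_continuous.
- move=> [k Kk kp]; have := @punctureP _ _ k; apply.
  by apply: etrans e; rewrite -kp actVK.
- move=> z zp.
  have zq : phi g z <> q by rewrite -e => /act_inj.
  have : [set: puncture q] (mk_puncture zq) by [].
  rewrite -HK => -[h _ [k Kk /(congr1 val) /= hk]].
  exists (conj_stab e h), (phi g^-1%g (val k)); split; first by exists k.
  apply: (act_inj (f := phi) (g := g)); rewrite -hk /=.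
  by rewrite conjgE -!actM !mulgA mulgV mul1g mulgK.
Qed.

(** Conjugation by g matches the set defining the gluing at q with the one in [limits_dominate] and
    [limits_within] at p. *)
Lemma hits_transport (S : set Z) :
  conj_stab e @` hits (puncture_action phi q) K (set_val @^-1` S) =
  [set k | exists2 z, K' z & (phi g^-1%g @` S) (phi (\val k) z)].
Proof.
apply/seteqP.
split=> [_ [h [_ [[k Kk <-] /= Sk]] <-]|k [_ [v Kv <-] [s Ss sE]]].
  exists (phi g^-1%g (val k)); first by exists k.
  exists (phi (val h) (val k)) => //=.
  by rewrite conjgE -!actM !mulgA mulgK.
have [c cK dK] := conj_stab_bij e.
exists (c k) => //; exists (puncture_action phi q (c k) v); split.
  by exists v.
suff vs : phi (\val (c k)) (val v) = s.
  change (S (phi (\val (c k)) (val v))).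
  by rewrite vs.
apply: (act_inj (f := phi) (g := g^-1%g)).
by rewrite sE -[k in RHS]dK /= conjgE -!actM !mulgA mulgK.
Qed.

(** The preimage of [B] consists of the preimage of [S] off the fiber and a compact part [R] of the
    fiber. Closure points of the former off the fiber are handled by continuity of [alpha]; those on
    the fiber lie, by [limits_dominate], in a boundary that [B] contains. *)
Lemma coordinate_continuous : continuous coordinate.
Proof.
apply: continuous_closed_preimage => B; rewrite closed_glueE.
move=> [/closed_val_preimageP[F cF BF] cBr Bd].
pose S := F `&` [set~ q].
pose R := psi g @` (set_val @` (inr @^-1` B : set C)).
have cR : closed R.
  apply: compact_closed => //; apply: continuous_compact.
    by apply: continuous_subspaceT; exact: act_continuous.
  apply: compact_val_image; 
  apply: (subclosed_compact cBr (B := setT)) => //.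
  exact: (compact_set_type cptX (@closed_fiber _ _ hsdfZ _ alpha_cont p)).
have Rq x : R x -> alpha x = q.
  by move=> [_ [c _ <-] <-]; apply: fiber_forth; exact: (set_mem (valP c)).
have BE : coordinate @^-1` B = alpha @^-1` S `|` R.
  apply/seteqP; split=> x /=.
    rewrite /coordinate; case: pselect => xq Bx.
      right; exists (psi g^-1%g x); last by rewrite actVK.
      by exists (SigSub (mem_set (fiber_back xq))).
    left; split=> //.
    by have : (set_val @^-1` F) (mk_puncture xq) by rewrite -BF.
  case=> [[Fx xq]|[_ [c Bc <-] <-]]; last by rewrite coordinate_fiber.
  rewrite (coordinate_inl xq).
  suff : (inl @^-1` B) (mk_puncture xq) by [].
  by rewrite BF.
rewrite BE => x; rewrite closureU => -[Sx|]; last by move/cR; right.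
have Fx : F (alpha x).
  apply: (closed_preimage_continuous alpha_cont cF).
  by apply: closureS Sx => y [].
have [xq|xq] := pselect (alpha x = q); last by left.
right; exists (psi g^-1%g x); last by rewrite actVK.
exists (SigSub (mem_set (fiber_back xq))) => //.
apply: Bd.
change (limit_set N (conj_stab e @` hits (puncture_action phi q) K
  (inl @^-1` B)) (psi g^-1%g x)).
rewrite (_ : inl @^-1` B = set_val @^-1` S); last first.
  rewrite BF; apply/seteqP; split=> y; last by case.
  by move=> Fy; split=> //; exact: punctureP.
rewrite hits_transport; apply: (Ndom spreading_transport).
  by move=> [s [_ sq] sp]; apply: sq; rewrite /= -e -sp actVK.
split; first exact: fiber_back.
move=> U Ux.
have : nbhs x (psi g^-1%g @^-1` U) by exact: act_continuous.
move=> /Sx[y [Sy Uy]]; exists (psi g^-1%g y); split=> //=.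
by rewrite alpha_equiv; exists (alpha y).
Qed.

(** Off the fiber the image is the trace of the compact set alpha(E); on the fiber it is the trace
    of g^-1 E, which by [limits_within] contains the boundary of the first part. *)
Lemma coordinate_closed E : closed E -> closed (coordinate @` E).
Proof.
move=> cE; set B := coordinate @` E.
have Bl : inl @^-1` B = set_val @^-1` (alpha @` E).
  apply/seteqP; split=> z.
    by move=> [x Ex /coordinate_eq_inl xz]; exists x.
  move=> [x Ex xz].
  have xq : alpha x <> q by rewrite xz; exact: punctureP.
  by exists x => //; rewrite (coordinate_inl xq); congr inl; apply: val_inj.
have Br : inr @^-1` B = set_val @^-1` (psi g @^-1` E) :> set C.
  apply/seteqP; split=> c.
    by move=> [x Ex /coordinate_eq_inr xc]; rewrite /= -xc.
  by move=> Ec; exists (psi g (val c)) => //; exact: coordinate_fiber.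
have cgE : closed (psi g @^-1` E).
  by apply: closed_preimage_continuous => //; exact: act_continuous.
rewrite closed_glueE; split.
- rewrite Bl; apply: closed_preimage_continuous.
    exact: initial_continuous.
  apply: compact_closed => //; apply: continuous_compact.
    exact: continuous_subspaceT.
  exact: subclosed_compact cE cptX _.
- rewrite Br; apply: closed_preimage_continuous => //.
  exact: initial_continuous.
- move=> c; rewrite Br => cB.
  apply: (Nwithin spreading_transport cgE).
  have {}cB : limit_set N (conj_stab e @` hits (puncture_action phi q) K
    (inl @^-1` B)) (val c) by exact: cB.
  move: cB; rewrite Bl hits_transport; apply: limit_setS => k [z Kz zE].
  exists z => //; move: zE => [_ [x Ex <-] <-].
  by exists (psi g^-1%g x); rewrite ?alpha_equiv //= actVK.
Qed.

(** The complements of disjoint neighborhoods are pushed forward by the closed surjection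
    [coordinate]; c and c' are avoided because each has a single preimage. *)
Lemma coordinate_sep (c c' : C) : c <> c' -> exists B B' : set pc,
  [/\ closed B, closed B', ~ B (inr c), ~ B' (inr c') & forall y, B y \/ B' y].
Proof.
move=> cc'; have cc : psi g (val c) <> psi g (val c').
  by move/act_inj/val_inj.
have [E [E' [cE cE' cEn cE'n EE']]] := closed_nbhs_sep cptX hsdfX cc.
have clo F : closed (~` F°) by rewrite closedC; exact: open_interior.
exists (coordinate @` (~` E°)), (coordinate @` (~` E'°)).
split; [exact: coordinate_closed|exact: coordinate_closed| | |].
- by move=> [x nEx /coordinate_eq_inr xc]; apply: nEx; rewrite xc.
- by move=> [x nEx /coordinate_eq_inr xc]; apply: nEx; rewrite xc.
- move=> y; have [x <-] := coordinate_surj y.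
  have [Ex|nEx] := EM (E° x); last by left; exists x.
  right; exists x => // E'x; suff : (E `&` E') x by rewrite EE'.
  by split; exact: interior_subset.
Qed.

End Coordinate.

(** * The blowup *)

Lemma prod_topology_continuous (I : Type) (Y : I -> topologicalType)
    (X : topologicalType) (f : X -> prod_topology Y) :
  (forall i, continuous (fun x => f x i)) -> continuous f.
Proof.
move=> fc x; apply/cvg_sup => i; move: x.
apply/(@continuousP _ (initial_topology (@^~ i))) => A [B oB <-].
by have /continuousP := fc i; apply.
Qed.

Lemma continuous_bijection_homeomorphism (X Y : topologicalType) (f : X -> Y) :
  compact [set: X] -> hausdorff_space Y -> continuous f -> injective f ->
  (forall y, exists x, f x = y) -> homeomorphism f.
Proof.
move=> cptX hsdfY fc finj fsurj; split=> //.
pose g y := projT1 (cid (fsurj y)).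
have gK : cancel g f by move=> y; rewrite /g; case: cid.
have fK : cancel f g by move=> x; apply: finj; rewrite gK.
exists g; split=> //; apply: continuous_closed_preimage => E cE.
rewrite (_ : g @^-1` E = f @` E); last first.
  apply/seteqP; split=> [y Ey|_ [x Ex <-]]; last by rewrite /= fK.
  by exists (g y).
apply: compact_closed => //; apply: continuous_compact.
  exact: continuous_subspaceT.
exact: subclosed_compact cE cptX _.
Qed.

(** * Orbit representatives of parabolic points *)

Section OrbitRepresentatives.
Variables (G : groupType) (Z : topologicalType) (phi : action G Z).
Local Notation P := (parabolic_points phi).

Definition g_orbit (z : Z) : set Z := [set phi g z | g in [set: G]].

Lemma g_orbit_act g z : g_orbit (phi g z) = g_orbit z.
Proof.
apply/seteqP; split=> _ [h _ <-]; first by exists (h * g)%g; rewrite ?actM.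
by exists (h * g^-1)%g; rewrite // actM actK.
Qed.

Definition orbit_rep (z : Z) : Z := xget z (g_orbit z).

Lemma orbit_repP z : g_orbit z (orbit_rep z).
Proof. by apply: xgetPex; exists z; exists 1%g; rewrite ?act1. Qed.

Lemma orbit_rep_act g z : orbit_rep (phi g z) = orbit_rep z.
Proof.
(* The two choices are made from the same orbit and differ only in the default value, which a
   nonempty set never reaches. *)
rewrite /orbit_rep g_orbit_act /xget; case: pselect => // -[].
by exists z; apply/asboolP; exists 1%g; rewrite ?act1.
Qed.

Lemma orbit_transporter z : {g | phi g (orbit_rep z) = z}.
Proof.
apply: cid; have [g _ gz] := orbit_repP z.
by exists g^-1%g; rewrite -gz actK.
Qed.

Definition rep_set : set Z := orbit_rep @` P.

Lemma rep_set_parabolic : rep_set `<=` P.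
Proof.
move=> _ [z Pz <-]; have [g _ <-] := orbit_repP z; exact: bounded_parabolic_act.
Qed.

Lemma rep_set_uniq (r r' : rep_set) g : phi g (\val r) = \val r' -> r = r'.
Proof.
have repE (t : rep_set) : orbit_rep (\val t) = \val t.
  have [z _ <-] := set_mem (valP t); have [h _ hz] := orbit_repP z.
  by rewrite -{1}hz orbit_rep_act.
move=> E; apply: val_inj.
by rewrite -(repE r) -(repE r') -E orbit_rep_act.
Qed.

Definition rep_of (q : P) : rep_set :=
  SigSub (mem_set (ex_intro2 _ _ (\val q) (set_mem (valP q)) erefl
    : rep_set (orbit_rep (\val q)))).

Definition rep_transporter (q : P) : G :=
  if orbit_rep (\val q) == \val q then 1%g
  else projT1 (orbit_transporter (\val q)).

Lemma rep_transporterE q : phi (rep_transporter q) (\val (rep_of q)) = \val q.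
Proof.
rewrite /rep_transporter /=; case: eqP => [E|_]; first by rewrite act1.
by case: orbit_transporter.
Qed.

Lemma rep_transporter1 q : \val (rep_of q) = \val q -> rep_transporter q = 1%g.
Proof. by rewrite /rep_transporter /= => E; case: eqP. Qed.

End OrbitRepresentatives.

(** * The equivariant bijection of X onto the blowup *)

Section Assembly.
Variables (G : groupType) (X Z : topologicalType).
Hypotheses (cptX : compact [set: X]) (hsdfX : hausdorff_space X).
Hypothesis hsdfZ : hausdorff_space Z.
Variables (psi : action G X) (phi : action G Z) (alpha : X -> Z).
Hypotheses (alpha_cont : continuous alpha)
  (alpha_surj : forall z, exists x, alpha x = z)
  (alpha_equiv : forall g x, alpha (psi g x) = phi g (alpha x))
  (alpha_fiber : forall z, ~ parabolic_points phi z -> exists! x, alpha x = z)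
  (psi_conv : forall p, parabolic_points phi p ->
     convergence_property (stab_restrict phi p psi))
  (nondeg : ~ ([set: Z] #= `I_1 /\ [set: X] #= `I_2)).

Local Notation P := (parabolic_points phi).

Definition rep_nearness (p : rep_set phi) :
  {N | [/\ nearness (stab_restrict phi (\val p) psi)
             (alpha @^-1` [set \val p]) N,
           limits_dominate alpha N & limits_within alpha N]}.
Proof.
have pP := rep_set_parabolic (set_mem (valP p)).
exact: cid (fiber_nearness cptX hsdfX hsdfZ alpha_cont alpha_surj alpha_equiv
  pP (psi_conv pP) nondeg).
Qed.

Definition rep_near (p : rep_set phi) := projT1 (rep_nearness p).

Lemma rep_nearP (p : rep_set phi) :
  nearness (stab_restrict phi (\val p) psi) (alpha @^-1` [set \val p])
    (@rep_near p).
Proof. by case: (projT2 (rep_nearness p)). Qed.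

Lemma rep_dom (p : rep_set phi) : limits_dominate alpha (@rep_near p).
Proof. by case: (projT2 (rep_nearness p)). Qed.

Lemma rep_within (p : rep_set phi) : limits_within alpha (@rep_near p).
Proof. by case: (projT2 (rep_nearness p)). Qed.

Definition rep_EPers (p : rep_set phi) : EPers (stab phi (\val p)) :=
  limit_EPers cptX hsdfX (@closed_fiber _ _ hsdfZ _ alpha_cont (\val p))
    (@fiber_act _ _ _ psi phi _ alpha_equiv (\val p)) (rep_nearP p).

Definition fundamental (q : P) :
    {K | cocompact_by (puncture_action phi (\val q)) K} :=
  cid (set_mem (valP q)).2.

Definition fiber_family : blowup_family phi := {|
  bf_reps := rep_set phi;
  bf_reps_parabolic := @rep_set_parabolic _ _ phi;
  bf_rep := @rep_of _ _ phi;
  bf_h := @rep_transporter _ _ phi;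
  bf_hE := @rep_transporterE _ _ phi;
  bf_reps_uniq := @rep_set_uniq _ _ phi;
  bf_h1 := @rep_transporter1 _ _ phi;
  bf_eper := rep_EPers;
  bf_K := fun q => projT1 (fundamental q);
  bf_KP := fun q => projT2 (fundamental q) |}.

Local Notation D := fiber_family.

Definition coord (q : P) (x : X) : piece D q :=
  coordinate alpha_equiv (rep_transporterE q) (rep_nearP (rep_of q))
    (bf_K D q) x.

Lemma coord_proj q x : piece_proj (coord q x) = alpha x.
Proof. by rewrite /coord /coordinate; case: pselect. Qed.

Lemma coord_continuous q : continuous (coord q).
Proof.
exact: (@coordinate_continuous _ _ _ cptX hsdfX hsdfZ psi phi alpha
  alpha_cont alpha_equiv _ _ _ (rep_transporterE q) _ (rep_nearP (rep_of q))
  (@rep_dom (rep_of q)) _ (bf_KP D q)).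
Qed.

Definition to_blowup (x : X) : blowup D :=
  SigSub (mem_set ((fun q => coord_proj q x)
    : blowup_set (alpha x, coord^~ x))).

Lemma to_blowup_continuous : continuous to_blowup.
Proof.
have pc : continuous (fun x => (coord^~ x : prod_topology (piece D))).
  by apply: prod_topology_continuous => q; exact: coord_continuous.
apply: continuous_comp_initial => x.
exact: (cvg_pair (@alpha_cont x) (pc x)).
Qed.

(** Over a parabolic q the coordinate at q determines the point of the fiber; over any other point
    the fiber is a singleton. *)
Lemma to_blowup_inj : injective to_blowup.
Proof.
move=> x y E.
have Exy : alpha x = alpha y by move: (congr1 (fun b => (\val b).1) E).
have Ec q : coord q x = coord q y by move: (congr1 (fun b => (\val b).2 q) E).
have [zP|zP] := pselect (P (alpha x)).
  pose q : P := SigSub (mem_set zP).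
  have := Ec q; rewrite /coord.
  rewrite (coordinate_inr _ _ _ _ (erefl : alpha x = \val q)) => /esym Ey.
  by rewrite (coordinate_eq_inr Ey) /= actVK.
by have [w [_ wu]] := alpha_fiber zP; rewrite -(wu x) // -(wu y).
Qed.

Lemma to_blowup_surj b : exists x, to_blowup x = b.
Proof.
have cz := set_mem (valP b); case bE : (\val b) cz => [z c] /= cz.
(* A coordinate at q different from z is determined by z, so only the coordinate at z has to be
   matched. *)
suff [x xz xc] : exists2 x, alpha x = z &
    forall q : P, \val q = z -> coord q x = c q.
  exists x; apply: val_inj; rewrite bE /=; congr (_, _) => //.
  apply: functional_extensionality_dep => q.
  have [/xc //|qz] := EM (\val q = z).
  have := cz q; have := coord_proj q x; rewrite /= xz.
  case: (coord q x) => [v|v] /= vz; last by case: qz.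
  case: (c q) => [v'|v'] /= vz'; last by case: qz.
  by congr inl; apply: val_inj; exact: etrans vz (esym vz').
have [zP|zP] := pselect (P z); last first.
  have [x [xz _]] := alpha_fiber zP.
  by exists x => // q qz; case: zP; rewrite -qz; exact: (set_mem (valP q)).
pose q : P := SigSub (mem_set zP).
have [x xq] : exists x, coord q x = c q by exact: coordinate_surj.
exists x; first by rewrite -(coord_proj q x) xq cz.
move=> q' qz; have -> // : q' = q by exact: val_inj.
Qed.

(** Points with different images in Z are separated there. Otherwise they differ in some coordinate
    q; both entries then lie in the fiber, where [coordinate_sep] applies. *)
Lemma blowup_hausdorff : hausdorff_space (blowup D).
Proof.
have val_cont : continuous (set_val : blowup D -> _).
  exact: initial_continuous.
have pull (T : topologicalType) (f : blowup D -> T) (b b' : blowup D) :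
    continuous f ->
    (exists B B', [/\ closed B, closed B', ~ B (f b), ~ B' (f b')
      & forall y, B y \/ B' y]) ->
    exists B B', [/\ closed B, closed B', ~ B b, ~ B' b'
      & forall y, B y \/ B' y].
  move=> fc [B [B' [cB cB' Bb B'b BB']]].
  exists (f @^-1` B), (f @^-1` B'); split=> //.
  + exact: closed_preimage_continuous fc cB.
  + exact: closed_preimage_continuous fc cB'.
  + by move=> y; exact: BB'.
apply: hausdorff_closed_cover => b b' bb'.
have [E1|E1] := EM ((\val b).1 = (\val b').1); last first.
  apply: (pull _ (fun b => (\val b).1)).
    by move=> x; exact: (cvg_comp _ _ (val_cont x) cvg_fst).
  move: hsdfZ; rewrite open_hausdorff => /(_ _ _ (introN eqP E1)).
  move=> [[U V]] /=; rewrite !inE => -[Ub Vb] [oU oV UV].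
  exists (~` U), (~` V); split; rewrite ?closedC //; try by apply.
  move=> y; have [Uy|?] := EM (U y); last by left.
  right=> Vy; suff : (U `&` V) y by rewrite UV.
  by [].
have [q cq] : exists q, (\val b).2 q <> (\val b').2 q.
  apply: contrapT => nq; apply: bb'; apply: val_inj.
  rewrite [LHS]surjective_pairing [RHS]surjective_pairing E1; congr (_, _).
  apply: functional_extensionality_dep => q; apply: contrapT => cq.
  by apply: nq; exists q.
apply: (pull _ (fun b => (\val b).2 q)).
  have snd_cont : continuous (fun b : blowup D => (\val b).2).
    by move=> x; exact: (cvg_comp _ _ (val_cont x) cvg_snd).
  move=> x.
  exact: (cvg_comp _ _ (snd_cont x) (@proj_continuous _ (piece D) q _)).
have := set_mem (valP b) q; have := set_mem (valP b') q; move: cq; rewrite -E1.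
case: ((\val b).2 q) => [v|v]; case: ((\val b').2 q) => [v'|v'] cq /= <-.
- by move=> vv; case: cq; congr inl; exact: val_inj.
- by move=> vq; case: (punctureP vq).
- by move=> /esym vq; case: (punctureP vq).
move=> _; apply: (@coordinate_sep _ _ _ cptX hsdfX hsdfZ psi phi alpha
  alpha_cont alpha_surj alpha_equiv _ _ _ (rep_transporterE q) _
  (rep_nearP (rep_of q)) (@rep_within (rep_of q)) _ (bf_KP D q)).
by move=> vv; apply: cq; rewrite vv.
Qed.

Lemma val_cast (p p' : rep_set phi) (E : p = p')
    (c : alpha @^-1` [set \val p]) :
  \val (eq_rect p (fun r => ep_space (rep_EPers r)) c p' E
    : set_type (alpha @^-1` [set \val p'])) = \val c.
Proof. by case: p' / E. Qed.

Lemma to_blowup_equivariant g x :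
  to_blowup (psi g x) = blowup_act g (to_blowup x).
Proof.
apply: val_inj => /=; congr (_, _); first exact: alpha_equiv.
apply: functional_extensionality_dep => q.
set q' := act_point g^-1%g q; set e := act_pointVK g q.
have [xq|xq] := EM (alpha x = \val q').
  have gxq : alpha (psi g x) = \val q by rewrite alpha_equiv xq.
  rewrite /coord (coordinate_inr _ _ _ _ gxq) (coordinate_inr _ _ _ _ xq) /=.
  (* With h and h' the transporters of q and q', what remains is h^-1 (g x) = (h^-1 g h') (h'^-1
     x). *)
  congr inr; apply: val_inj; rewrite /fiber_move val_cast /=.
  by rewrite -!actM mulgK.
have gxq : alpha (psi g x) <> \val q.
  by rewrite alpha_equiv -e => /act_inj.
rewrite /coord (coordinate_inl _ _ _ _ gxq) (coordinate_inl _ _ _ _ xq) /=.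
by congr inl; apply: val_inj; exact: alpha_equiv.
Qed.

End Assembly.

Theorem theorem3p1 (G : groupType) (X Z : topologicalType)
  (cptX : compact [set: X]) (hsdfX : hausdorff_space X)
  (cptZ : compact [set: Z]) (hsdfZ : hausdorff_space Z)
  (psi : action G X) (phi : action G Z) (alpha : X -> Z)
  (alpha_cont : continuous alpha)
  (alpha_surj : forall z, exists x, alpha x = z)
  (alpha_equiv : forall g x, alpha (psi g x) = phi g (alpha x))
  (alpha_fiber : forall z, ~ parabolic_points phi z ->
     exists! x, alpha x = z)
  (psi_conv : forall p, parabolic_points phi p ->
     convergence_property (stab_restrict phi p psi))
  (nondeg : ~ ([set: Z] #= `I_1 /\ [set: X] #= `I_2)) :
  exists (D : blowup_family phi) (T : X -> blowup D),
    [/\ homeomorphism T,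
        forall g x, T (psi g x) = blowup_act g (T x) &
        @blowup_proj _ _ _ D \o T = alpha].
Proof.
exists (fiber_family cptX hsdfX hsdfZ alpha_cont alpha_surj alpha_equiv
  psi_conv nondeg).
exists (to_blowup cptX hsdfX hsdfZ alpha_cont alpha_surj alpha_equiv
  psi_conv nondeg); split.
- apply: continuous_bijection_homeomorphism => //.
  + exact: blowup_hausdorff.
  + exact: to_blowup_continuous.
  + exact: to_blowup_inj.
  + exact: to_blowup_surj.
- exact: to_blowup_equivariant.
- by [].
Qed.
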